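(* Let $d\ge 1$, $S\in\tfrac12\mathbb{N}=\{\tfrac12,1,\tfrac32,\dots\}$, $u\in[0,1]$ and $\beta>0$. Let $L$ be an even integer, $\Lambda=\{-\tfrac12L,\dots,\tfrac12L\}^d\subset\mathbb{Z}^d$, and $\mathcal{E}_\Lambda$ the set of (unordered) nearest-neighbour pairs $xy$ with $x,y\in\Lambda$. Let $\mathbf{h}=(h_x)_{x\in\Lambda}$ with $h_x\in[0,\infty)$ and consider on $\mathcal{H}_\Lambda=\bigotimes_{x\in\Lambda}\mathbb{C}^{2S+1}$ the Hamiltonian \[ H_{\Lambda,\mathbf{h}}=-\sum_{xy\in\mathcal{E}_\Lambda}\bigl(uT_{xy}+(1-u)Q_{xy}-1\bigr)-\sum_{x\in\Lambda}h_xS^3_x , \] with states $\langle M\rangle_{\Lambda,\mathbf{h}}=\operatorname{Tr}(Me^{-\beta H_{\Lambda,\mathbf{h}}})/\operatorname{Tr}e^{-\beta H_{\Lambda,\mathbf{h}}}$. Assume that $h_x\ge\alpha$ for all $x\in\Lambda$, for some $\alpha>0$. Then there exist constants $C,c>0$, depending on $S,d,\alpha$ but not on $L$ or $\beta$, such that \[ 0<\langle S^1_0S^1_x\rangle_{\Lambda,\mathbf{h}}<Ce^{-c\|x\|}\qquad\text{for all }x\in\Lambda . \]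
   Context: Let $|a\rangle$, $a=-S,-S+1,\dots,S$, be the basis of $\mathbb{C}^{2S+1}$ of eigenvectors of the spin operator $S^3$, $S^3|a\rangle=a|a\rangle$; $S^1,S^2,S^3$ are the standard spin-$S$ operators (satisfying $[S^1,S^2]=iS^3$ and cyclic permutations), and $S^i_x$ denotes $S^i$ acting on the factor at site $x$. The transposition operator $T_{xy}$ acts on $\mathbb{C}^{2S+1}\otimes\mathbb{C}^{2S+1}$ (sites $x,y$) by $T_{xy}|a\rangle_x\otimes|b\rangle_y=|b\rangle_x\otimes|a\rangle_y$, and $Q_{xy}$ has matrix elements $\langle a|_x\otimes\langle b|_y\,Q_{xy}\,|c\rangle_x\otimes|d\rangle_y=\delta_{a,b}\delta_{c,d}$. For $S=\tfrac12$ this Hamiltonian equals $-2\sum_{xy}(S^1_xS^1_y+(2u-1)S^2_xS^2_y+S^3_xS^3_y-\tfrac14)-\sum_x h_xS^3_x$ (e.g. $u=1$ Heisenberg ferromagnet, $u=\tfrac12$ XY model). $\|x\|$ denotes the (Euclidean) norm of $x\in\mathbb{Z}^d$. *)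

(* Defs.v *)
From HB Require Import structures.
From mathcomp Require Import all_boot all_order all_algebra.
From mathcomp Require Import all_classical all_reals all_analysis.
Set Implicit Arguments.
Unset Strict Implicit.
Unset Printing Implicit Defensive.
Import Order.TTheory GRing.Theory Num.Theory.
Import numFieldNormedType.Exports.
Local Open Scope ring_scope.

Section Spin.
Variables (R : realType) (d l m : nat).
(* L = 2 * l ; 2S = m ; local dimension 2S+1 = m.+1 *)

(* sites of Lambda = {-L/2,...,L/2}^d : coordinate i of x is (x i) - l *)
Definition site := {ffun 'I_d -> 'I_(2 * l).+1}.
Definition coord (x : site) (i : 'I_d) : int := (x i)%:Z - l%:Z.
Definition origin : site := [ffun _ => inord l].
Definition nn (x y : site) : bool :=
  (\sum_(i < d) absz (coord x i - coord y i) == 1)%N.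
Definition eucl_norm (x : site) : R :=
  Num.sqrt (\sum_(i < d) ((coord x i)%:~R : R) ^+ 2).

(* basis configurations of H_Lambda: sigma x = k means |k - S>_x *)
Definition cfg := {ffun site -> 'I_m.+1}.
Definition Mx := 'M[R]_#|cfg|.
Definition mx_of (f : cfg -> cfg -> R) : Mx :=
  \matrix_(i, j) f (enum_val i) (enum_val j).

Definition spinS : R := m%:R / 2.
Definition spin_val (k : 'I_m.+1) : R := k%:R - spinS.

Definition S3_loc (a b : 'I_m.+1) : R := (a == b)%:R * spin_val a.
Definition S1_loc (a b : 'I_m.+1) : R :=
  if ((a : nat) == b.+1) || ((b : nat) == a.+1)
  then Num.sqrt (spinS * (spinS + 1) - spin_val a * spin_val b) / 2
  else 0.

Definition agree_off (sigma tau : cfg) (P : pred site) : bool :=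
  [forall z, P z || (sigma z == tau z)].

Definition at_site (A : 'I_m.+1 -> 'I_m.+1 -> R) (x : site) : Mx :=
  mx_of (fun sigma tau => A (sigma x) (tau x) * (agree_off sigma tau (pred1 x))%:R).
Definition S1_op (x : site) : Mx := at_site S1_loc x.
Definition S3_op (x : site) : Mx := at_site S3_loc x.

Definition T_op (x y : site) : Mx :=
  mx_of (fun sigma tau =>
    [&& sigma x == tau y, sigma y == tau x &
        agree_off sigma tau [pred z | (z == x) || (z == y)]]%:R).
Definition Q_op (x y : site) : Mx :=
  mx_of (fun sigma tau =>
    [&& sigma x == sigma y, tau x == tau y &
        agree_off sigma tau [pred z | (z == x) || (z == y)]]%:R).

(* H = - sum_{xy in E} (u T + (1-u) Q - 1) - sum_x h_x S^3_x ;
   each unordered edge counted once via enum_rank x < enum_rank y *)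
Definition hamiltonian (u : R) (h : site -> R) : Mx :=
  - (\sum_(x : site) \sum_(y : site | nn x y && (enum_rank x < enum_rank y)%N)
        (u *: T_op x y + (1 - u) *: Q_op x y - 1%:M))
  - \sum_(x : site) h x *: S3_op x.

Definition expmx (A : Mx) : Mx :=
  \matrix_(i, j) limn (fun N : nat => ((\sum_(k < N) (k`!%:R)^-1 *: (A ^+ k)) i j : R)).

Definition gibbs (beta u : R) (h : site -> R) (M : Mx) : R :=
  \tr (M *m expmx (- beta *: hamiltonian u h)) /
  \tr (expmx (- beta *: hamiltonian u h)).

End Spin.

(* Main.v *)
(** Write [-H = K - |E| + F] with [K] the couplings and [F] the field, and
    approximate [e^(-beta H)] by [(e^(dF) (1 + d (K - |E|)))^M], [d = beta / M].
    Expanding the product gives a sum over sets of links in space-time and over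
    spin configurations that are constant along every link.

    Domination: raising the spin on the component with the smaller value does
    not decrease the weight, so imposing one more equality of spins costs at
    most a factor [2(2S+1)].  Removing a [T] or [Q] link is possible after
    imposing one equality; hence links are dominated by a Bernoulli field of
    density of order [d].

    Decay: [S^1_0 S^1_x] cuts the configuration at [0] and [x] at time [0].  By
    conservation of parity the two components of the cut at [0] both reach [x],
    and raising the lower one gains [e^(-alpha |K|)], [|K|] its duration.
    Either [|K| >= eps |x|_1], or [0] and [x] are joined by a chain of [|x|_1]
    distinct links of short total duration, which a union bound excludes up to
    an exponentially small probability.  All constants are uniform in [M].

    Positivity: [-H] plus a constant has nonnegative entries and moves one
    excitation from [0] to [x] with [T] links, or two sites at a time with [Q]
    links; when [u = 0] and [|x|_1] is odd, it annihilates a pair of excitations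
    at [0] and [x]. *)

Require Import Defs.
From HB Require Import structures.
From mathcomp Require Import all_boot all_order all_algebra.
From mathcomp Require Import perm.
From mathcomp Require Import all_classical all_reals all_analysis.
From mathcomp Require Import zify ring lra.
Set Implicit Arguments.
Unset Strict Implicit.
Unset Printing Implicit Defensive.
Import Order.TTheory GRing.Theory Num.Theory.
Import numFieldNormedType.Exports.
Local Open Scope ring_scope.

(** * Matrix exponential as a limit of powers *)

Section RowBound.
Variables (R : realType) (n : nat).
Implicit Types (A B : 'M[R]_n).

(** The operator norm for the sup norm, kept as a predicate on its upper bounds; it is
    submultiplicative and dominates every entry. *)
Definition rowbnd A (c : R) : Prop := forall i, \sum_j `|A i j| <= c.

Lemma rowbnd_entry A c i j : rowbnd A c -> `|A i j| <= c.
Proof. by move=> /(_ i); rewrite (bigD1 j) //=; apply: le_trans; rewrite lerDl sumr_ge0. Qed.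

Lemma rowbnd_le A c c' : c <= c' -> rowbnd A c -> rowbnd A c'.
Proof. by move=> cc H i; apply: le_trans (H i) cc. Qed.

Lemma rowbndD A B a b : rowbnd A a -> rowbnd B b -> rowbnd (A + B) (a + b).
Proof.
move=> HA HB i; apply: le_trans (lerD (HA i) (HB i)); rewrite -big_split /=.
by apply: ler_sum => j _; rewrite mxE ler_normD.
Qed.

Lemma rowbndZ A a x : rowbnd A a -> rowbnd (x *: A) (`|x| * a).
Proof.
move=> HA i; apply: le_trans (ler_wpM2l (normr_ge0 x) (HA i)).
by rewrite mulr_sumr; apply: ler_sum => j _; rewrite mxE normrM.
Qed.

Lemma rowbndM A B a b : 0 <= b -> rowbnd A a -> rowbnd B b -> rowbnd (A * B) (a * b).
Proof.
move=> b0 HA HB i.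
apply: (@le_trans _ _ (\sum_j \sum_k `|A i k| * `|B k j|)).
  apply: ler_sum => j _; rewrite mxE; apply: le_trans (ler_norm_sum _ _ _) _.
  by apply: ler_sum => k _; rewrite normrM.
rewrite exchange_big /=; apply: le_trans (ler_wpM2r b0 (HA i)).
by rewrite mulr_suml; apply: ler_sum => k _; rewrite -mulr_sumr ler_wpM2l.
Qed.

Lemma rowbnd1 : rowbnd 1 1.
Proof.
move=> i; rewrite (bigD1 i) //= big1 ?addr0 => [|j ji]; rewrite mxE ?eqxx ?normr1 //.
by rewrite eq_sym (negbTE ji) normr0.
Qed.

Lemma rowbndX A a k : 0 <= a -> rowbnd A a -> rowbnd (A ^+ k) (a ^+ k).
Proof.
move=> a0 HA; elim: k => [|k IH]; first by rewrite !expr0; apply: rowbnd1.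
by rewrite !exprS; apply: rowbndM => //; rewrite exprn_ge0.
Qed.

Lemma rowbnd_sum (I : Type) (r : seq I) (F : I -> 'M[R]_n) (f : I -> R) :
  (forall i, rowbnd (F i) (f i)) -> rowbnd (\sum_(i <- r) F i) (\sum_(i <- r) f i).
Proof.
move=> H; elim: r => [|i r IH]; last by rewrite !big_cons; apply: rowbndD.
by move=> i; rewrite !big_nil big1 // => j _; rewrite mxE normr0.
Qed.

(** Telescoping: [A^(k+1) - B^(k+1) = A^k (A - B) + (A^k - B^k) B]. Since [1 <= c], the first term
    may also be charged with [c^(k+1)]. *)
Lemma rowbnd_subX A B c e k : 1 <= c -> 0 <= e ->
  rowbnd A c -> rowbnd B c -> rowbnd (A - B) e ->
  rowbnd (A ^+ k - B ^+ k) (k%:R * e * c ^+ k).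
Proof.
move=> c1 e0 HA HB HAB; have c0 : 0 <= c by apply: le_trans c1.
elim: k => [|k IH]; first by rewrite !expr0 subrr !mul0r => i; rewrite big1 // => j _; rewrite mxE normr0.
have -> : A ^+ k.+1 - B ^+ k.+1 = A ^+ k * (A - B) + (A ^+ k - B ^+ k) * B.
  by rewrite mulrBr mulrBl -!exprSr addrA subrK.
apply: rowbnd_le (rowbndD (rowbndM e0 (rowbndX k c0 HA) HAB) (rowbndM c0 IH HB)).
rewrite -[k.+1]addn1 natrD !mulrDl mul1r exprD expr1 addrC.
rewrite mulrA lerD2l mulrC ler_wpM2l // ler_peMr ?exprn_ge0 //.
Qed.

End RowBound.

(** * The scalar limit of [(1 + b / N)^N] *)

Section ScalarExp.
Variable R : realType.

Lemma expr_bernoulli (s : R) k : 0 <= s <= 1 -> 1 - k%:R * s <= (1 - s) ^+ k.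
Proof.
move=> /andP[s0 s1]; elim: k => [|k IH]; first by rewrite mul0r subr0 expr0.
rewrite exprS; apply: (@le_trans _ _ ((1 - s) * (1 - k%:R * s))).
  have k0 : 0 <= k%:R :> R by rewrite ler0n.
  rewrite -[k.+1]addn1 natrD; nra.
by rewrite ler_wpM2l // subr_ge0.
Qed.

(** With [t = b / (k+1)], the upper bound is [1 + t <= e^t]. For the lower one, [e^t (1 - t) <= 1]
    gives [e^t (1 - t^2) <= 1 + t], and Bernoulli's inequality treats the power of [1 - t^2]. *)
Lemma compound_bounds (b : R) k : 0 <= b -> b <= k.+1%:R ->
  expR b * (1 - b ^+ 2 / k.+1%:R) <= (1 + k.+1%:R^-1 * b) ^+ k.+1 <= expR b.
Proof.
move=> b0 bk; set t := _ * b.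
have k0 : 0 < k.+1%:R :> R by rewrite ltr0n.
have tb : k.+1%:R * t = b by rewrite /t mulrA divff ?mul1r // gt_eqF.
have t0 : 0 <= t by rewrite mulr_ge0 // invr_ge0 ltW.
have t1 : t <= 1 by rewrite /t mulrC ler_pdivrMr // mul1r.
have -> : expR b = expR t ^+ k.+1 by rewrite -expRM_natl tb.
apply/andP; split; last by rewrite lerXn2r ?nnegrE ?expR_ge0 ?expR_ge1Dx // addr_ge0.
have -> : b ^+ 2 / k.+1%:R = k.+1%:R * t ^+ 2.
  by rewrite -tb exprMn; field; rewrite gt_eqF.
have ts : 0 <= t ^+ 2 <= 1 by rewrite exprn_ge0 //= exprn_ile1.
apply: (@le_trans _ _ (expR t ^+ k.+1 * (1 - t ^+ 2) ^+ k.+1)).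
  by rewrite ler_wpM2l ?exprn_ge0 ?expR_ge0 // expr_bernoulli.
have ts0 : 0 <= 1 - t ^+ 2 by rewrite subr_ge0; case/andP: ts.
rewrite -exprMn; apply: lerXn2r; rewrite ?nnegrE.
- by rewrite mulr_ge0 ?expR_ge0.
- by rewrite addr_ge0.
have e : expR t * (1 - t) <= 1.
  have := expR_ge1Dx (- t); rewrite expRN => h.
  by rewrite -ler_pdivlMl ?expR_gt0 // mulr1.
have -> : expR t * (1 - t ^+ 2) = (expR t * (1 - t)) * (1 + t) by ring.
by rewrite ler_piMl // addr_ge0.
Qed.

Lemma cvg_compound (b : R) : 0 <= b ->
  ((fun k => (1 + k.+1%:R^-1 * b) ^+ k.+1) @ \oo --> expR b)%classic.
Proof.
move=> b0; apply: (@squeeze_cvgr _ _ _ _ (fun k => expR b * (1 - b ^+ 2 * harmonic k)) (fun=> expR b)).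
- near=> k; apply: compound_bounds => //.
  near: k; exists (Num.truncn b) => //= k bk.
  by apply: le_trans (ltW (truncnS_gt b)) _; rewrite ler_nat.
- rewrite -[X in (_ --> X)%classic]mulr1; apply: cvgM; first exact: cvg_cst.
  rewrite -[X in (_ --> X)%classic]subr0.
  apply: cvgB; first exact: cvg_cst.
  by rewrite -(mulr0 (b ^+ 2)); apply: cvgM; [exact: cvg_cst|exact: cvg_harmonic].
- exact: cvg_cst.
Unshelve. all: by end_near.
Qed.

End ScalarExp.

(** * Products of approximate slices converge to the matrix exponential *)

Section Trotter.
Variables (R : realType) (n : nat).
Implicit Types (B : 'M[R]_n).

Definition exppart B (N : nat) : 'M[R]_n := \sum_(k < N) (k`!%:R)^-1 *: (B ^+ k).

Lemma rowbnd_exists B : exists2 b, 0 <= b & rowbnd B b.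
Proof.
exists (\sum_i \sum_j `|B i j|) => [|i]; first by do 2!apply: sumr_ge0 => ? _.
by rewrite [leRHS](bigD1 i) //= lerDl; do 2!apply: sumr_ge0 => ? _.
Qed.

Lemma exppart_cvg B i j : cvgn (fun N => exppart B N i j : R).
Proof.
have [b b0 Hb] := rowbnd_exists B.
pose u k : R := (k`!%:R)^-1 * (B ^+ k) i j.
have -> : (fun N => exppart B N i j) = series u.
  apply/funext => N; rewrite /series /= big_mkord /exppart summxE.
  by apply: eq_bigr => k _; rewrite mxE.
apply: (@normed_cvg R R^o); apply: series_le_cvg (is_cvg_series_exp_coeff b) => k.
- exact: normr_ge0.
- exact: exp_coeff_ge0.
- rewrite /u /exp_coeff /= normrM mulrC [`|_^-1|]ger0_norm ?invr_ge0 ?ler0n //.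
  by rewrite ler_wpM2r ?invr_ge0 ?ler0n //; apply: rowbnd_entry (rowbndX k b0 Hb).
Qed.

Lemma scalemxX B (y : R) k : (y *: B) ^+ k = y ^+ k *: B ^+ k.
Proof.
elim: k => [|k IH]; first by rewrite !expr0 scale1r.
rewrite !exprS IH; change ((y *: B) *m (y ^+ k *: B ^+ k) = (y * y ^+ k) *: (B *m B ^+ k)).
by rewrite -scalemxAl -scalemxAr scalerA.
Qed.

(* Coefficientwise, [(1 + B / N) ^ N] is dominated by the exponential series, so
   the matrix error is bounded by the scalar one. *)
Lemma rowbnd_compound B b N : 0 <= b -> rowbnd B b ->
  rowbnd (exppart B N.+2 - (1 + N.+1%:R^-1 *: B) ^+ N.+1)
    (\sum_(k < N.+2) (k`!%:R)^-1 * b ^+ k - (1 + N.+1%:R^-1 * b) ^+ N.+1).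
Proof.
move=> b0 Hb; set y := N.+1%:R^-1.
pose a (k : nat) : R := (k`!%:R)^-1 - y ^+ k *+ 'C(N.+1, k).
(* With [n = N+1], this is [n (n-1) ... (n-k+1) <= n^k]. *)
have a0 k : 0 <= a k.
  rewrite subr_ge0 -mulr_natr /y exprVn mulrC ler_pdivrMr; last by rewrite exprn_gt0 ?ltr0n.
  rewrite ler_pdivlMl ?ltr0n ?fact_gt0 // -natrM -natrX ler_nat mulnC bin_ffact.
  by rewrite ffact_prod -[k in leqRHS]card_ord -prod_nat_const; apply: leq_prod => i _; apply: leq_subr.
have -> : exppart B N.+2 - (1 + y *: B) ^+ N.+1 = \sum_(k < N.+2) a k *: B ^+ k.
  rewrite addrC [1 + _]addrC exprD1n addrC /exppart -sumrB; apply: eq_bigr => k _.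
  by rewrite scalemxX /a scalerBl scalerMnl.
have -> : \sum_(k < N.+2) (k`!%:R)^-1 * b ^+ k - (1 + y * b) ^+ N.+1 = \sum_(k < N.+2) a k * b ^+ k.
  rewrite [1 + _]addrC exprD1n -sumrB; apply: eq_bigr => k _.
  by rewrite exprMn /a mulrBl mulrnAl.
apply: rowbnd_sum => k; rewrite -[X in X * _]ger0_norm //; apply: rowbndZ.
exact: rowbndX.
Qed.

(** Each of the [N+1] factors is off by [O(N^-2)], so the product is within [O(1/N)] of the compound
    power, which tends to the exponential. The bound is asked only eventually, since slices are
    controlled for small time steps only. *)
Lemma trotter B (P : nat -> 'M[R]_n) (C : R) i j :
  (\forall N \near (\oo)%classic, rowbnd (P N - (1 + N.+1%:R^-1 *: B)) (C / N.+1%:R ^+ 2)) ->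
  ((fun N => (P N ^+ N.+1) i j) @ \oo --> limn (fun N => exppart B N i j : R))%classic.
Proof.
move=> HP; have [b b0 Hb] := rowbnd_exists B.
wlog C0 : C HP / 0 <= C.
  move=> /(_ `|C|); apply => //; apply: filterS HP => N; apply: rowbnd_le.
  by rewrite ler_wpM2r ?invr_ge0 ?exprn_ge0 ?ler0n // ler_norm.
have E : ((fun N => exppart B N.+2 i j) @ \oo --> limn (fun N => exppart B N i j : R))%classic.
  have : cvgn (fun N => exppart B N i j : R) by exact: exppart_cvg.
  move: (limn _) => l.
  by rewrite -(cvg_shiftS (fun N => exppart B N i j)) -(cvg_shiftS (fun N => exppart B N.+1 i j)).
apply: (cvg_sub0 (g := fun N => exppart B N.+2 i j)) => //; apply: norm_cvg0.
pose g N : R := C * expR (b + C) * harmonic N +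
   (\sum_(k < N.+2) (k`!%:R)^-1 * b ^+ k - (1 + N.+1%:R^-1 * b) ^+ N.+1).
apply: (@squeeze_cvgr _ _ _ _ (cst 0) g).
- apply: filterS HP => N HN; rewrite normr_ge0 /=.
  set Y := 1 + _ in HN; pose y := N.+1%:R^-1 : R.
  have y0 : 0 <= y by rewrite invr_ge0 ler0n.
  have y1 : y <= 1 by rewrite invf_le1 ?ltr0n // ler1n.
  rewrite -[X in `|X|]/((P N ^+ N.+1) i j - exppart B N.+2 i j).
  have -> : (P N ^+ N.+1) i j - exppart B N.+2 i j =
     (P N ^+ N.+1 - Y ^+ N.+1) i j - (exppart B N.+2 - Y ^+ N.+1) i j.
    by rewrite !mxE; ring.
  apply: le_trans (ler_normB _ _) _; apply: lerD; last first.
    by apply: rowbnd_entry; apply: rowbnd_compound.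
  (* A common row bound for [P N] and [Y]; its power [c^(N+1)] is at most [e^(b + C)], uniformly in
     [N]. *)
  pose c : R := 1 + y * b + C * y ^+ 2.
  have HY : rowbnd Y (1 + y * b).
    by apply: rowbndD; [exact: rowbnd1|rewrite -[y in y * b]ger0_norm //; apply: rowbndZ].
  have eps : C / N.+1%:R ^+ 2 = C * y ^+ 2 by rewrite /y exprVn.
  have eps0 : 0 <= C * y ^+ 2 by rewrite mulr_ge0 ?exprn_ge0.
  have HPN : rowbnd (P N) c.
    by have := rowbndD HY HN; rewrite addrC subrK eps.
  have c1 : 1 <= c by rewrite /c -addrA lerDl addr_ge0 ?mulr_ge0.
  have HY' : rowbnd Y c by apply: rowbnd_le HY; rewrite lerDl.
  rewrite eps in HN.
  apply: le_trans (rowbnd_entry i j (rowbnd_subX N.+1 c1 eps0 HPN HY' HN)) _.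
  have Ny : N.+1%:R * y = 1 by rewrite divff // pnatr_eq0.
  have -> : N.+1%:R * (C * y ^+ 2) = C * y.
    by rewrite mulrCA expr2 [N.+1%:R * (y * y)]mulrA Ny mul1r.
  have -> : harmonic N = y by [].
  rewrite [leRHS]mulrAC ler_wpM2l ?mulr_ge0 //.
  apply: (@le_trans _ _ (expR (y * b + C * y ^+ 2) ^+ N.+1)).
    apply: lerXn2r; rewrite ?nnegrE ?expR_ge0 ?(le_trans ler01) //.
    by rewrite /c -addrA expR_ge1Dx.
  rewrite -expRM_natl ler_expR mulrDr mulrA Ny mul1r lerD2l mulrCA expr2 [N.+1%:R * (y * y)]mulrA Ny mul1r.
  by rewrite ler_piMr.
- exact: cvg_cst.
- rewrite -[X in (_ --> X)%classic]addr0; apply: cvgD.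
    rewrite -[X in (_ --> X)%classic](mulr0 (C * expR (b + C))).
    by apply: cvgM; [exact: cvg_cst|exact: cvg_harmonic].
  rewrite -[X in (_ --> X)%classic](subrr (expR b)); apply: cvgB; last exact: cvg_compound.
  have -> : (fun N : nat => \sum_(k < N.+2) (k`!%:R)^-1 * b ^+ k) =
            (fun N => series (exp_coeff b) N.+2).
    apply/funext => N; rewrite /series /= big_mkord; apply: eq_bigr => k _.
    by rewrite mulrC.
  rewrite (cvg_shiftS (fun N => series (exp_coeff b) N.+1)) (cvg_shiftS (series _)).
  exact: is_cvg_series_exp_coeff.
Qed.

End Trotter.

(** * Equality constraints and spin flips *)

(** The tag recovers [a] from [phi a], so every [b] has at most [#|K|] preimages. All comparisons of
    partition functions below go through this bound. *)
Lemma ler_sum_inj (R : realType) (A B K : finType) (P : pred A) (Q : pred B)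
    (f : A -> R) (g : B -> R) (phi : A -> B) (tag : A -> K) :
  (forall b, Q b -> 0 <= g b) ->
  (forall a, P a -> Q (phi a)) ->
  (forall a, P a -> f a <= g (phi a)) ->
  {in P &, injective (fun a => (phi a, tag a))} ->
  \sum_(a | P a) f a <= #|K|%:R * \sum_(b | Q b) g b.
Proof.
move=> g0 PQ fg inj; apply: (@le_trans _ _ (\sum_(a | P a) g (phi a))).
  exact: ler_sum.
rewrite (partition_big phi Q) //= mulr_sumr; apply: ler_sum => b Qb.
rewrite (eq_bigr (fun=> g b)); last by move=> a /andP[_ /eqP->].
rewrite sumr_const -[leLHS]mulr_natl ler_wpM2r ?g0 // ler_nat.
apply: (@leq_card_in _ _ tag) => a a' /andP[Pa /eqP ea] /andP[Pa' /eqP ea'] et.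
by apply: inj => //=; rewrite et ea ea'.
Qed.

Section Flip.
Variables (R : realType) (m : nat) (V : finType) (r : rel V) (eta : V -> R).
Hypothesis eta_ge0 : forall v, 0 <= eta v.
Implicit Types (s : {ffun V -> 'I_m.+1}) (u v : V).

Definition symrel u v := r u v || r v u.
Definition compat s := [forall u, forall v, r u v ==> (s u == s v)].
Definition weight s : R := expR (\sum_v eta v * spin_val R (s v)).
Definition flip s u (b : 'I_m.+1) : {ffun V -> 'I_m.+1} :=
  [ffun v => if connect symrel u v then b else s v].
Definition lift_lower s u v :=
  if (s u <= s v)%N then flip s u (s v) else flip s v (s u).
(** What [lift_lower] forgets: which component was raised, and its former value. *)
Definition lower_tag s u v : bool * 'I_m.+1 :=
  ((s u <= s v)%N, if (s u <= s v)%N then s u else s v).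

Lemma compatP s : reflect (forall u v, r u v -> s u = s v) (compat s).
Proof.
apply: (iffP forallP) => H u.
  by move=> v ruv; have /forallP/(_ v)/implyP/(_ ruv)/eqP := H u.
by apply/forallP => v; apply/implyP => /H ->.
Qed.

Lemma symrel_sym : connect_sym symrel.
Proof. by apply: sym_connect_sym => u v; rewrite /symrel orbC. Qed.

Lemma compat_connect s u v : compat s -> connect symrel u v -> s u = s v.
Proof.
move=> /compatP H /connectP[p]; elim: p u => [|w p IH] u /=; first by move=> _ ->.
move=> /andP[/orP[/H->|/H<-] pth] e; exact: IH.
Qed.

Lemma flip_compat s u b : compat s -> compat (flip s u b).
Proof.
move=> /compatP H; apply/compatP => v w rvw; rewrite !ffunE (H _ _ rvw).
have -> // : connect symrel u v = connect symrel u w.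
have c : connect symrel v w by apply: connect1; rewrite /symrel rvw.
exact: (same_connect_r symrel_sym).
Qed.

Lemma flipK s u b : compat s -> flip (flip s u b) u (s u) = s.
Proof.
move=> H; apply/ffunP => v; rewrite !ffunE.
by case c: (connect _ _ _) => //; apply: compat_connect c.
Qed.

Lemma flip_u s u b : flip s u b u = b.
Proof. by rewrite ffunE connect0. Qed.

Lemma weight_flip s u (b : 'I_m.+1) : compat s ->
  weight s = expR (- (b%:R - (s u)%:R) * \sum_(v | connect symrel u v) eta v)
             * weight (flip s u b).
Proof.
move=> H; rewrite /weight -expRD; congr expR.
rewrite (bigID (connect symrel u)) [X in _ = _ + X](bigID (connect symrel u)) /=.
rewrite addrA; congr (_ + _); last first.
  by apply: eq_bigr => v /negbTE c; rewrite ffunE c.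
rewrite mulr_sumr -big_split /=; apply: eq_bigr => v c.
rewrite ffunE c (compat_connect H c) /spin_val; ring.
Qed.

Lemma lift_lower_compat s u v : compat s -> compat (lift_lower s u v).
Proof. by move=> H; rewrite /lift_lower; case: ifP => _; apply: flip_compat. Qed.

Lemma lift_lower_eq s u v : lift_lower s u v u = lift_lower s u v v.
Proof. by rewrite /lift_lower; case: ifP => _; rewrite flip_u ffunE; case: ifP. Qed.

Lemma lift_lower_inj u v :
  {in compat &, injective (fun s => (lift_lower s u v, lower_tag s u v))}.
Proof.
move=> s s' cs cs' [] /= e e1 e2; move: e e2; rewrite /lift_lower -e1.
case: ifP => _ e e2.
  by rewrite -(@flipK s u (s v)) // e e2 flipK.
by rewrite -(@flipK s v (s u)) // e e2 flipK.
Qed.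

Lemma weight_lift_lower s u v : compat s -> weight s <= weight (lift_lower s u v).
Proof.
move=> H; rewrite /lift_lower; case: (leqP (s u) (s v)) => l;
  [rewrite [leLHS](weight_flip u (s v) H)|rewrite [leLHS](weight_flip v (s u) H)];
  rewrite ler_piMl ?expR_ge0 // expR_le1 mulNr oppr_le0;
  by rewrite mulr_ge0 ?sumr_ge0 // subr_ge0 ler_nat //; exact: ltnW.
Qed.

Lemma weight_lift_lower_gain s u v G : compat s -> s u != s v ->
  expR (- \sum_(w | connect symrel u w) eta w) <= G ->
  expR (- \sum_(w | connect symrel v w) eta w) <= G ->
  weight s <= G * weight (lift_lower s u v).
Proof.
have key a b k : (a < b)%N -> 0 <= k -> expR (- (b%:R - a%:R : R) * k) <= expR (- k).
  move=> ab k0; rewrite ler_expR mulNr lerN2 -subr_ge0 -[X in _ - X]mul1r -mulrBl.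
  by rewrite mulr_ge0 // subr_ge0 lerBrDl natr1 ler_nat.
move=> H ne Gu Gv; rewrite /lift_lower; case: (leqP (s u) (s v)) => l;
  [rewrite [leLHS](weight_flip u (s v) H)|rewrite [leLHS](weight_flip v (s u) H)];
  rewrite ler_wpM2r ?expR_ge0 //.
  apply: le_trans Gu; apply: key; last by rewrite sumr_ge0.
  by rewrite ltn_neqAle l andbT.
by apply: le_trans Gv; apply: key; last rewrite sumr_ge0.
Qed.

Lemma card_tag : #|{: bool * 'I_m.+1}| = (2 * m.+1)%N.
Proof. by rewrite card_prod card_bool card_ord. Qed.

(* Raising the component with the smaller value costs no weight, so adding one
   equality constraint loses at most a factor [2 * m.+1]. *)
Lemma sum_compat_merge u v :
  \sum_(s | compat s) weight s
    <= (2 * m.+1)%:R * \sum_(s | compat s && (s u == s v)) weight s.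
Proof.
rewrite -card_tag; apply: (@ler_sum_inj _ _ _ _ _ _ _ _
   (fun s => lift_lower s u v) (fun s => lower_tag s u v)).
- by move=> s _; apply: expR_ge0.
- by move=> s H; rewrite lift_lower_compat //= lift_lower_eq.
- by move=> s H; apply: weight_lift_lower.
- exact: lift_lower_inj.
Qed.

End Flip.

(** * Links in space-time *)

Section SpaceTime.
Variables (R : realType) (X : finType) (m M : nat).
Implicit Types (o : option (X * X * bool)) (y z : X).

(* [Some (a, b, true)] is a transposition link [T], [Some (a, b, false)] a [Q] link. *)
Definition link : Type := option (X * X * bool).
Definition point : Type := 'I_M.+1 * X.
Definition before (k : 'I_M) : 'I_M.+1 := widen_ord (leqnSn M) k.
Definition after (k : 'I_M) : 'I_M.+1 := lift ord0 k.

(** Strands going from one level to the next: a [T] link exchanges those at [a] and [b], while a [Q]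
    link interrupts both, its equalities lying inside the two levels, in [horiz]. *)
Definition cross o y z : bool :=
  if o is Some (a, b, c) then
    (c && ((y == a) && (z == b) || (y == b) && (z == a)))
    || [&& y == z, y != a & y != b]
  else y == z.
Definition horiz o y z : bool :=
  if o is Some (a, b, false) then (y == a) && (z == b) else false.

(** The body copies the 0-1 matrix elements of [T_op] and [Q_op], so that these reduce to it by
    conversion. *)
Definition step o (s t : {ffun X -> 'I_m.+1}) : bool :=
  let off a b := [forall y, ((y == a) || (y == b)) || (s y == t y)] in
  match o with
  | None => s == t
  | Some (a, b, true) => [&& s a == t b, s b == t a & off a b]
  | Some (a, b, false) => [&& s a == s b, t a == t b & off a b]
  end.

(** A link acts only through equalities of spins; hence, for given links, the allowed space-time
    configurations are exactly the functions constant on the components of a graph. *)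
Lemma stepP o (s t : {ffun X -> 'I_m.+1}) :
  reflect ((forall y z, cross o y z -> s y = t z) /\
           (forall y z, horiz o y z -> s y = s z /\ t y = t z)) (step o s t).
Proof.
case: o => [[[a b] []]|] /=.
- apply: (iffP and3P) => [[/eqP e1 /eqP e2 /forallP H]|[H _]]; split=> //.
  + move=> y z /orP[/orP[|]/andP[/eqP-> /eqP->] //|/and3P[/eqP<- ya yb]].
    by apply/eqP; have := H y; rewrite (negbTE ya) (negbTE yb).
  + by apply/eqP; apply: H; rewrite !eqxx.
  + by apply/eqP; apply: H; rewrite !eqxx orbT.
  + apply/forallP => y; case: eqP => //= ya; case: eqP => //= yb.
    by apply/eqP; apply: H; rewrite eqxx; move/eqP: ya => ->; move/eqP: yb => ->; rewrite orbT.
- apply: (iffP and3P) => [[/eqP e1 /eqP e2 /forallP H]|[H1 H2]]; split.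
  + move=> y z /and3P[/eqP<- ya yb].
    by apply/eqP; have := H y; rewrite (negbTE ya) (negbTE yb).
  + by move=> y z /andP[/eqP-> /eqP->].
  + by apply/eqP; apply: (H2 _ _ _).1; rewrite !eqxx.
  + by apply/eqP; apply: (H2 _ _ _).2; rewrite !eqxx.
  + apply/forallP => y; case: eqP => //= ya; case: eqP => //= yb.
    by apply/eqP; apply: H1; rewrite eqxx; move/eqP: ya => ->; move/eqP: yb => ->.
- apply: (iffP eqP) => [->|[H _]]; first by split => // y z /eqP->.
  by apply/ffunP => y; apply: H.
Qed.

Section Relation.
Variables (w : {ffun 'I_M -> link}) (cut : pred X).

(* The last disjunct closes the time circle, except above the sites in [cut]. *)
Definition strel (u v : point) : bool :=
  [exists k : 'I_M,
     [|| [&& u.1 == before k, v.1 == after k & cross (w k) u.2 v.2],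
         [&& u.1 == before k, v.1 == before k & horiz (w k) u.2 v.2]
       | [&& u.1 == after k, v.1 == after k & horiz (w k) u.2 v.2]]]
  || [&& u.1 == ord_max, v.1 == ord0, u.2 == v.2 & ~~ cut u.2].

Definition slice (s : {ffun point -> 'I_m.+1}) (i : 'I_M.+1) : {ffun X -> 'I_m.+1} :=
  [ffun y => s (i, y)].

Lemma compat_strelP s :
  reflect ((forall k, step (w k) (slice s (before k)) (slice s (after k))) /\
           (forall y, ~~ cut y -> s (ord_max, y) = s (ord0, y)))
          (compat strel s).
Proof.
apply: (iffP (compatP _ _)) => [H|[H1 H2] [i y] [j z]].
  split=> [k|y cy].
    apply/stepP; split=> y z h; rewrite !ffunE.
      by apply: H; apply/orP; left; apply/existsP; exists k; rewrite /= !eqxx h.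
    split; apply: H; apply/orP; left; apply/existsP; exists k.
      by rewrite /= !eqxx h orbT.
    by rewrite /= !eqxx h !orbT.
  by apply: H; rewrite /strel /= !eqxx cy orbT.
case/orP => [/existsP[k]|/= /and4P[/eqP-> /eqP-> /eqP-> cz]]; last exact: H2.
have /stepP[c h] := H1 k.
case/or3P => /= /and3P[/eqP-> /eqP-> hh].
- by have := c _ _ hh; rewrite !ffunE.
- by have := (h _ _ hh).1; rewrite !ffunE.
- by have := (h _ _ hh).2; rewrite !ffunE.
Qed.

End Relation.

Definition reset (w : {ffun 'I_M -> link}) (i : 'I_M) : {ffun 'I_M -> link} :=
  [ffun k => if k == i then None else w k].

Variable eta : point -> R.
Hypothesis eta_ge0 : forall v, 0 <= eta v.

Definition Zlink (w : {ffun 'I_M -> link}) : R :=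
  \sum_(s | compat (strel w pred0) s) weight eta (m := m) s.

Lemma Zlink_ge0 w : 0 <= Zlink w.
Proof. by apply: sumr_ge0 => s _; apply: expR_ge0. Qed.

(* One extra equality makes the four spins around a [T] or [Q] link equal, and
   such a configuration is also compatible with the absence of the link. *)
Lemma Zlink_reset w i : Zlink w <= (2 * m.+1)%:R * Zlink (reset w i).
Proof.
have T1 : 1 <= (2 * m.+1)%:R :> R by rewrite ler1n.
case e : (w i) => [[[a b] c]|]; last first.
  suff -> : reset w i = w by rewrite ler_peMl // Zlink_ge0.
  by apply/ffunP => k; rewrite ffunE; case: eqP => // ->.
pose u : point := (before i, a).
pose v : point := if c then (before i, b) else (after i, a).
apply: le_trans (@sum_compat_merge R m _ (strel w pred0) eta eta_ge0 u v) _.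
apply: ler_wpM2l; first by rewrite ler0n.
rewrite /Zlink [leLHS]big_mkcond [leRHS]big_mkcond; apply: ler_sum => s _.
case: ifP => [/andP[/compat_strelP[H1 H2] euv]|_]; last by case: ifP => _ //; apply: expR_ge0.
rewrite ifT //; apply/compat_strelP; split=> // k; rewrite ffunE.
case: eqP => // ->; rewrite /step; apply/eqP/ffunP => y; rewrite !ffunE.
have := H1 i; rewrite e /step.
case: c @v e euv => v e /eqP; rewrite /u /v /= => euv.
  rewrite !ffunE => /and3P[/eqP e1 /eqP e2 /forallP/(_ y)]; rewrite !ffunE.
  by case: eqP => [->|_]; [rewrite euv | case: eqP => [->|_ /= /eqP//]; rewrite -euv].
rewrite !ffunE => /and3P[/eqP e1 /eqP e2 /forallP/(_ y)]; rewrite !ffunE.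
by case: eqP => [->//|_]; case: eqP => [->|_ /= /eqP//]; rewrite -e1 -e2.
Qed.

Variable wt : link -> R.
Hypothesis wt_ge0 : forall o, 0 <= wt o.
Hypothesis wt0_gt0 : 0 < wt None.

Definition Wlink (w : {ffun 'I_M -> link}) : R := \prod_k wt (w k).

Lemma Wlink_ge0 w : 0 <= Wlink w.
Proof. by apply: prodr_ge0 => k _; apply: wt_ge0. Qed.

Lemma Wlink_reset w i : Wlink w = wt (w i) / wt None * Wlink (reset w i).
Proof.
rewrite /Wlink (bigD1 i) //= [in RHS](bigD1 i) //= ffunE eqxx.
rewrite mulrA divfK ?gt_eqF //; congr (_ * _).
by apply: eq_bigr => k /negbTE ki; rewrite ffunE ki.
Qed.

Definition occupied (w : {ffun 'I_M -> link}) (t : 'I_M * (X * X)) : bool :=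
  (w t.1 == Some (t.2, true)) || (w t.1 == Some (t.2, false)).

Definition weight_of_edge (e : X * X) : R := wt (Some (e, true)) + wt (Some (e, false)).

(** Domination by a Bernoulli field: prescribed links are removed one at a time, each for a factor
    [(2 * m.+1) * delta / wt None]. Distinct slots ensure that a removal leaves the other prescribed
    links in place, and for a fixed kind of link the removal is injective. *)
Lemma sum_occupied_le (c : seq ('I_M * (X * X))) (delta : R) :
  (forall e, weight_of_edge e <= delta) ->
  uniq (map fst c) ->
  \sum_(w | all (occupied w) c) Wlink w * Zlink w
    <= ((2 * m.+1)%:R * delta / wt None) ^+ size c * \sum_w Wlink w * Zlink w.
Proof.
move=> wd; elim: c => [|t c IH] /=; first by rewrite expr0 mul1r.
move=> /andP[tc uc]; set q := _ * _ / _.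
have d0 : 0 <= delta by apply: le_trans (wd t.2); rewrite addr_ge0.
have q0 : 0 <= q by rewrite !mulr_ge0 ?ler0n ?invr_ge0 ?(ltW wt0_gt0).
rewrite exprS -mulrA; apply: le_trans (ler_wpM2l q0 (IH uc)).
pose S b := \sum_(w : {ffun 'I_M -> link} | (w t.1 == Some (t.2, b)) && all (occupied w) c)
   Wlink w * Zlink w.
have Sb b : S b <= (2 * m.+1)%:R * wt (Some (t.2, b)) / wt None *
     \sum_(w | all (occupied w) c) Wlink w * Zlink w.
  have E : 1 = #|{: unit}|%:R :> R by rewrite card_unit.
  rewrite /S mulr_sumr -[leRHS]mul1r [X in _ <= X * _]E.
  apply: (@ler_sum_inj _ _ _ unit _ _ _ _ (fun w => reset w t.1) (fun=> tt)).
  - move=> w _; rewrite !mulr_ge0 ?ler0n ?wt_ge0 ?invr_ge0 ?(ltW wt0_gt0) //.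
    + exact: Wlink_ge0. + exact: Zlink_ge0.
  - move=> w /andP[_ /allP H]; apply/allP => t' t'c; have := H _ t'c.
    rewrite /occupied !ffunE; case: (t'.1 =P t.1) => // e.
    by case/negP: tc; rewrite -e; apply: (map_f fst).
  - move=> w /andP[/eqP e _]; rewrite (Wlink_reset w t.1) e.
    have z := Zlink_reset w t.1.
    rewrite -[leLHS]mulrA; apply: le_trans (ler_wpM2l _ (ler_wpM2l _ z)) _.
    + by rewrite mulr_ge0 ?wt_ge0 // invr_ge0 ltW.
    + exact: Wlink_ge0.
    + by rewrite le_eqVlt; apply/orP; left; apply/eqP; ring.
  - move=> w w' /andP[/eqP e _] /andP[/eqP e' _] [ew]; apply/ffunP => k.
    have := congr1 (fun f : {ffun 'I_M -> link} => f k) ew; rewrite !ffunE.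
    by case: eqP => // ->; rewrite e e'.
have -> : \sum_(w | occupied w t && all (occupied w) c) Wlink w * Zlink w = S true + S false.
  rewrite /S (bigID (fun w : {ffun 'I_M -> link} => w t.1 == Some (t.2, true))) /=.
  congr (_ + _); apply: eq_bigl => w; rewrite /occupied; case: eqP => [->|] //=;
    rewrite ?andbT ?andbF //=; case: eqP => //.
apply: le_trans (lerD (Sb true) (Sb false)) _; rewrite -mulrDl.
apply: ler_wpM2r.
  apply: sumr_ge0 => w _; rewrite mulr_ge0 //; [exact: Wlink_ge0|exact: Zlink_ge0].
by rewrite /q -mulrDl -mulrDr ler_wpM2r ?invr_ge0 ?(ltW wt0_gt0) // ler_wpM2l ?ler0n //; exact: wd.
Qed.

End SpaceTime.

(** * The cut configuration *)

Section Parity.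
Variables (X : finType) (M : nat) (ed : rel X).
Hypothesis ed_irr : forall a b, ed a b -> a != b.

Definition valid_link (o : link X) : bool := if o is Some (a, b, _) then ed a b else true.

Variables (w : {ffun 'I_M -> link X}) (o x : X).
Hypothesis w_valid : forall k, valid_link (w k).
Hypothesis ox : o != x.
Local Notation r := (strel w (pred2 o x)).

Lemma strel_cross k y z : cross (w k) y z -> r (before k, y) (after k, z).
Proof. by move=> c; apply/orP; left; apply/existsP; exists k; rewrite /= !eqxx c. Qed.

(** Take [chi] to be the indicator of a union of components. A [T] link permutes its points, and a
    [Q] link joins the points of a level in a pair, which counts for zero modulo 2; the parity of
    each level is therefore conserved. *)
Lemma parity_step (chi : pred (point X M)) k :
  (forall u v, r u v -> chi u = chi v) ->
  \big[addb/false]_y chi (before k, y) = \big[addb/false]_y chi (after k, y).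
Proof.
move=> H; have := w_valid k; case e : (w k) => [[[a b] []]|] /= vk; last first.
- by apply: eq_bigr => y _; apply: H; apply: strel_cross; rewrite e /=.
- have ba : b != a by rewrite eq_sym; apply: ed_irr.
  rewrite (bigD1 a) //= (bigD1 b) //= [RHS](bigD1 a) //= [X in _ = _ (+) X](bigD1 b) //=.
  rewrite !addbA; congr (_ (+) _); last first.
    apply: eq_bigr => y /andP[ya yb]; apply: H; apply: strel_cross.
    by rewrite e /= eqxx ya yb.
  have -> : chi (before k, a) = chi (before k, b).
    by apply: H; apply/orP; left; apply/existsP; exists k; rewrite /= e /= !eqxx orbT.
  have -> : chi (after k, a) = chi (after k, b).
    by apply: H; apply/orP; left; apply/existsP; exists k; rewrite /= e /= !eqxx !orbT.
  by rewrite !addbb.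
- rewrite [RHS](reindex_inj (@perm_inj _ (tperm a b))) /=; apply: eq_bigr => y _.
  apply: H; apply: strel_cross; rewrite e /=.
  case: tpermP => [->|->|/eqP ya /eqP yb]; rewrite ?eqxx ?orbT //.
  by rewrite ya yb orbT.
Qed.

Lemma parity_slices (chi : pred (point X M)) :
  (forall u v, r u v -> chi u = chi v) ->
  chi (ord0, o) (+) chi (ord0, x) = chi (ord_max, o) (+) chi (ord_max, x).
Proof.
move=> H.
have E n (h : (n < M.+1)%N) :
    \big[addb/false]_y chi (Ordinal h, y) = \big[addb/false]_y chi (ord0, y).
  elim: n h => [|n IH] h; first by apply: eq_bigr => y _; congr (chi (_, y)); apply: val_inj.
  have hM : (n < M)%N by [].
  rewrite -(IH (ltnW h)).
  have -> : Ordinal h = after (Ordinal hM) by apply: val_inj.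
  have -> : Ordinal (ltnW h) = before (Ordinal hM) by apply: val_inj.
  by rewrite parity_step.
have := E M (ltnSn M); have -> : Ordinal (ltnSn M) = ord_max by apply: val_inj.
rewrite (bigD1 o) //= (bigD1 x) 1?eq_sym //= [RHS](bigD1 o) //= [X in _ = _ (+) X -> _](bigD1 x) 1?eq_sym //=.
rewrite !addbA.
have -> : \big[addb/false]_(i | (i != o) && (i != x)) chi (ord_max, i) =
          \big[addb/false]_(i | (i != o) && (i != x)) chi (ord0, i).
  apply: eq_bigr => y /andP[yo yx]; apply: H; apply/orP; right.
  by rewrite /= !eqxx (negbTE yo) (negbTE yx).
by move=> /addIb ->.
Qed.

(** Parity of the component of [u]: it contains one of the two ends at [o] but not the other, and
    away from [o] and [x] the first and last levels are identified, so it contains exactly one end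
    at [x]. *)
Lemma connect_cut (u : point X M) :
  u = (ord0, o) \/ u = (ord_max, o) ->
  ~~ connect (symrel r) (ord0, o) (ord_max, o) ->
  connect (symrel r) u (ord0, x) || connect (symrel r) u (ord_max, x).
Proof.
have sym := symrel_sym r; move=> Hu nc.
have H v v' : r v v' -> connect (symrel r) u v = connect (symrel r) u v'.
  by move=> rv; apply: (same_connect_r sym); apply: connect1; rewrite /symrel rv.
have := parity_slices H; case: Hu => ->; rewrite connect0.
  by rewrite (negbTE nc); do 2!case: (connect _ _ _).
by rewrite sym (negbTE nc); do 2!case: (connect _ _ _).
Qed.

End Parity.

(** * Closing both cuts by raising one component *)

Section CutSum.
Variables (R : realType) (X : finType) (m M : nat) (ed : rel X).
Hypothesis ed_irr : forall a b, ed a b -> a != b.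
Variables (w : {ffun 'I_M -> link X}) (o x : X).
Hypothesis w_valid : forall k, valid_link ed (w k).
Hypothesis ox : o != x.
Variable eta : point X M -> R.
Hypothesis eta_ge0 : forall v, 0 <= eta v.
Local Notation r := (strel w (pred2 o x)).

Definition Zcut : R :=
  \sum_(s | [&& compat r s, s (ord0, o) != s (ord_max, o)
             & s (ord0, x) != s (ord_max, x)]) weight eta (m := m) s.

(** Raising the lower of the two components that start at the ends of [o] closes the cut at [o]. As
    these components contain one end at [x] each, the same move closes the cut at [x], and it gains
    the factor [G]. *)
Lemma Zcut_le (G : R) : 0 <= G ->
  (forall u : point X M, u = (ord0, o) \/ u = (ord_max, o) ->
     connect (symrel r) u (ord0, x) || connect (symrel r) u (ord_max, x) ->
     expR (- \sum_(v | connect (symrel r) u v) eta v) <= G) ->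
  Zcut <= (2 * m.+1)%:R * (G * Zlink m eta w).
Proof.
move=> G0 HG; rewrite -(card_tag m) /Zcut /Zlink mulr_sumr.
pose u0 : point X M := (ord0, o); pose u1 : point X M := (ord_max, o).
apply: (@ler_sum_inj _ _ _ _ _ _ _ _
   (fun s => lift_lower r s u0 u1) (fun s => lower_tag s u0 u1)).
- by move=> s _; rewrite mulr_ge0 ?expR_ge0.
- move=> s /and3P[cs so sx].
  have nc : ~~ connect (symrel r) u0 u1.
    by apply: contra so => c; rewrite (compat_connect cs c).
  have c0 := connect_cut ed_irr w_valid ox (or_introl erefl) nc.
  have c1 := connect_cut ed_irr w_valid ox (or_intror erefl) nc.
  have /compat_strelP[H1 H2] := lift_lower_compat u0 u1 cs.
  apply/compat_strelP; split=> // y _.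
  case: (boolP (pred2 o x y)) => [/orP[/eqP->|/eqP->]|]; last exact: H2.
    by rewrite -/u0 -/u1 lift_lower_eq.
  have sym := symrel_sym r.
  have disj v : connect (symrel r) u0 v -> ~~ connect (symrel r) u1 v.
    move=> cv; apply: contra nc => cv'; apply: connect_trans cv _; by rewrite sym.
  have xne : ~~ connect (symrel r) (ord0, x) (ord_max, x).
    by apply: contra sx => c; rewrite (compat_connect cs c).
  have both u : connect (symrel r) u (ord0, x) -> ~~ connect (symrel r) u (ord_max, x).
    move=> cv; apply: contra xne => cv'; apply: connect_trans cv'; by rewrite sym.
  have e0 v : connect (symrel r) u0 v -> s v = s u0 by move=> /(compat_connect cs).
  have e1 v : connect (symrel r) u1 v -> s v = s u1 by move=> /(compat_connect cs).
  have := c0; rewrite -/u0 => c0'; have := c1; rewrite -/u1 => c1'.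
  (* The two components are disjoint, so the cases where both contain the same end at [x] are void;
     in the other two, raising one component equates the two ends at [x]. *)
  case/orP: c0' => a0; case/orP: c1' => a1.
  + by have := disj _ a0; rewrite a1.
  + rewrite /lift_lower; case: ifP => _; rewrite !ffunE.
      by rewrite a0 (negbTE (both _ a0)) (e1 _ a1).
    by rewrite a1 (e0 _ a0); case: ifP.
  + rewrite /lift_lower; case: ifP => _; rewrite !ffunE.
      by rewrite a0 (e1 _ a1); case: ifP.
    by rewrite a1 (negbTE (both _ a1)) (e0 _ a0).
  + by have := disj _ a0; rewrite a1.
- move=> s /and3P[cs so sx].
  have nc : ~~ connect (symrel r) u0 u1.
    by apply: contra so => c; rewrite (compat_connect cs c).
  apply: weight_lift_lower_gain => //; apply: HG; rewrite ?/u0 ?/u1; try tauto;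
    by apply: (connect_cut ed_irr w_valid ox _ nc); tauto.
- by move=> s s' /and3P[cs _ _] /and3P[cs' _ _]; apply: lift_lower_inj.
Qed.

End CutSum.

(** * Chains of links *)

Lemma big_tuple_cons (R : realType) (T : finType) n (F : n.+1.-tuple T -> R) :
  \sum_c F c = \sum_t \sum_(c : n.-tuple T) F [tuple of t :: c].
Proof.
rewrite pair_big /=.
rewrite (reindex (fun p : T * n.-tuple T => [tuple of p.1 :: p.2])) //=.
exists (fun c : n.+1.-tuple T => (thead c, [tuple of behead c])).
  by move=> [t c] _ /=; congr (_, _); apply: val_inj.
by move=> c _; case/tupleP: c => t c; apply: val_inj.
Qed.

Section Chains.
Variables (X : finType) (M : nat) (ed : rel X).
Implicit Types (c : seq ('I_M * (X * X))) (t : 'I_M * (X * X)).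

(* Distance on the time circle of length [M]; the levels [0] and [M] coincide. *)
Definition cdist (a b : nat) : nat :=
  minn (maxn a b - minn a b) (M - (maxn a b - minn a b)).
(** Both levels adjacent to the slot [k] are within distance one of it. *)
Lemma cdist_link j k a b : (j < M)%N -> (k < M)%N ->
  (a == k) || (a == k.+1) -> (b == k) || (b == k.+1) ->
  (cdist j k + cdist k b <= cdist j a + 2)%N.
Proof. by rewrite /cdist => jM kM /orP[] /eqP-> /orP[] /eqP->; lia. Qed.

Fixpoint cost (j : nat) c : nat := if c is t :: c' then cdist j t.1 + cost t.1 c' else 0.
Definition touch (e : X * X) (y : X) : bool := (y == e.1) || (y == e.2).
Definition share (e e' : X * X) : bool := touch e e'.1 || touch e e'.2.
(** Only the second pair must be an edge, so that a chain can start from the degenerate pair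
    [(o, o)]. *)
Definition next t t' : bool := ed t'.2.1 t'.2.2 && share t.2 t'.2.

Lemma cost_cat j c c' : cost j (c ++ c') = (cost j c + cost (last j (map (val \o fst) c)) c')%N.
Proof. by elim: c j => //= t c IH j; rewrite IH addnA. Qed.

Lemma last_level t c : last (t.1 : nat) (map (val \o fst) c) = (last t c).1.
Proof. exact: (last_map (val \o fst) c t). Qed.

(** Consecutive pairs share a site, so each new edge raises [f] by at most one. *)
Lemma chain_touch (f : X -> nat) n t c y :
  (forall a b, ed a b -> (f a <= (f b).+1)%N && (f b <= (f a).+1)%N) ->
  (forall z, touch t.2 z -> (f z <= n)%N) ->
  path next t c -> touch (last t c).2 y -> (f y <= n + size c)%N.
Proof.
move=> Hf; elim: c t n => [|t' c IH] t n Ht /=; first by move=> _ /Ht; rewrite addn0.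
move=> /andP[/andP[e sh] pth] /(IH t' n.+1 _ pth); rewrite addnS addSn; apply.
move=> z tz; have /andP[f1 f2] := Hf _ _ e.
case/orP: sh => /Ht fs; case/orP: tz => /eqP->; lia.
Qed.

Section Extract.
Variable i0 : 'I_M.
Hypothesis i0E : (i0 : nat) = 0%N.
Variables (w : {ffun 'I_M -> link X}) (cut : pred X) (o : X).
Hypothesis w_valid : forall k, valid_link ed (w k).
Let t0 : 'I_M * (X * X) := (i0, (o, o)).
Local Notation r := (strel w cut).

(** What is retained of a walk of [n] steps from [o]: the links it used, in distinct slots, with a
    time budget of two units per step. *)
Definition reached n (v : point X M) : Prop :=
  exists c, [/\ path next t0 c, uniq (map fst c), all (occupied w) c,
    touch (last t0 c).2 v.2 & (cost 0 c + cdist (last t0 c).1 v.1 <= 2 * n)%N].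

(** A step either stays above its site and changes the time by at most one, or takes place at a link
    touching both sites. Closing the time circle is of the first kind, because [cdist] does not
    separate the levels [0] and [M]. *)
Lemma symrel_cases (u v : point X M) : symrel r u v ->
  (u.2 = v.2 /\ forall j, (j <= M)%N -> (cdist j v.1 <= (cdist j u.1).+1)%N) \/
  exists k a b, [/\ occupied w (k, (a, b)), touch (a, b) u.2, touch (a, b) v.2,
    (u.1 == k :> nat) || (u.1 == k.+1 :> nat) & (v.1 == k :> nat) || (v.1 == k.+1 :> nat)].
Proof.
have bE k : (before k : nat) = k by [].
have aE k : (after k : nat) = k.+1 by [].
have half (u' v' : point X M) : r u' v' ->
  (u'.2 = v'.2 /\ forall j, (j <= M)%N ->
     (cdist j v'.1 <= (cdist j u'.1).+1)%N /\ (cdist j u'.1 <= (cdist j v'.1).+1)%N) \/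
  exists k a b, [/\ occupied w (k, (a, b)), touch (a, b) u'.2, touch (a, b) v'.2,
    (u'.1 == k :> nat) || (u'.1 == k.+1 :> nat) & (v'.1 == k :> nat) || (v'.1 == k.+1 :> nat)].
  move: u' v' => [i y] [j z] /orP[/existsP[k]|/= /and4P[/eqP-> /eqP-> /eqP-> _]]; last first.
    by left; split => // l lM; rewrite /cdist /=; lia.
  have hz : horiz (w k) y z -> exists a b, [/\ occupied w (k, (a, b)), touch (a, b) y & touch (a, b) z].
    rewrite /horiz /occupied /touch; case: (w k) => [[[a b] []]|] //= /andP[/eqP-> /eqP->].
    by exists a, b; rewrite !eqxx !orbT.
  case/or3P => /= /and3P[/eqP-> /eqP->].
  - move=> cr; have lk := ltn_ord k.
    have D : (y = z) \/ exists a b, [/\ occupied w (k, (a, b)), touch (a, b) y & touch (a, b) z].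
      move: cr; rewrite /cross /occupied /touch; case: (w k) => [[[a b] [|]]|] /=.
      + case/orP => [/orP[|] /andP[/eqP-> /eqP->]|/and3P[/eqP->]]; last by left.
          by right; exists a, b; rewrite !eqxx orbT.
        by right; exists a, b; rewrite !eqxx orbT.
      + by move=> /and3P[/eqP->]; left.
      + by move=> /eqP->; left.
    case: D => [->|[a [b [? ? ?]]]].
      by left; split=> // l lM; rewrite bE aE /cdist; lia.
    by right; exists k, a, b; rewrite bE aE !eqxx orbT.
  - by move=> /hz[a [b [? ? ?]]]; right; exists k, a, b; rewrite bE !eqxx.
  - by move=> /hz[a [b [? ? ?]]]; right; exists k, a, b; rewrite aE !eqxx !orbT.
case/orP => /half[[e H]|[k [a [b [? ? ? ? ?]]]]].
- by left; split=> // j jM; have [] := H _ jM.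
- by right; exists k, a, b.
- by left; split=> // j jM; have [] := H _ jM.
- by right; exists k, a, b.
Qed.

(* A repeated slot is handled by cutting the chain back to its first visit. *)
Lemma reached_step n u v : symrel r u v -> reached n u -> reached n.+1 v.
Proof.
move=> /symrel_cases H [c [pc uc oc tc cc]].
have lM t : ((t.1 : nat) < M)%N by apply: ltn_ord.
case: H => [[e D]|[k [a [b [ok tu tv lu lv]]]]].
  exists c; rewrite -e; split=> //.
  have := D _ (ltnW (lM (last t0 c))); lia.
pose t : 'I_M * (X * X) := (k, (a, b)).
have kM := ltn_ord k.
have eab : ed a b by have := w_valid k; case/orP: ok => /= /eqP->.
case: (boolP (k \in map fst c)) => [/mapP[t' t'c kt]|kc]; last first.
  exists (rcons c t); split.
  - rewrite rcons_path pc /= /next eab /share /=.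
    move: tc tu; rewrite /touch /=; case: (last t0 c) => _ [p q] /= /orP[/eqP->|/eqP->] /orP[/eqP->|/eqP->];
      by rewrite !eqxx ?orbT.
  - by rewrite map_rcons rcons_uniq uc kc.
  - by rewrite all_rcons ok oc.
  - by rewrite last_rcons.
  - rewrite last_rcons -cats1 cost_cat /= addn0.
    have -> : last 0%N (map (val \o fst) c) = (last t0 c).1 by rewrite -last_level /= i0E.
    have := cdist_link (lM (last t0 c)) kM lu lv => dl.
    apply: (@leq_trans (cost 0 c + cdist (last t0 c).1 u.1 + 2)%N); first by rewrite -!addnA leq_add2l.
    by rewrite mulnS addnC leq_add2l.
have tt : t' = t.
  have := allP oc _ t'c; have := ok; rewrite /occupied /t -kt /=.
  case: t' kt {t'c} => k' [a' b'] /= <-.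
  by case/orP => /eqP -> /orP[] //= /eqP [-> ->].
case/splitPr: t'c pc uc oc cc tc => c1 c2; rewrite tt -cat_rcons.
rewrite cat_path map_cat cat_uniq all_cat => /andP[p1 _] /andP[u1 _] /andP[a1 _].
rewrite cost_cat => cc _.
exists (rcons c1 t); split=> //; first by rewrite last_rcons.
rewrite last_rcons /=.
have : (cdist k v.1 <= 1)%N.
  clear -lv; rewrite /cdist; case/orP: lv => /eqP ->; lia.
have le1 : (cost 0 (rcons c1 t) <= 2 * n)%N.
  by apply: leq_trans cc; rewrite -addnA leq_addr.
by move=> le2; apply: leq_trans (leq_add le1 le2) _; rewrite mulnS addnC leq_add2r.
Qed.

Lemma reached_path (u : point X M) p : u.2 = o -> u = (ord0, o) \/ u = (ord_max, o) ->
  path (symrel r) u p -> reached (size p) (last u p).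
Proof.
move=> u2 Hu; elim/last_ind: p => [|p v IH] /=.
  move=> _; exists [::]; split => //=; rewrite /touch /= ?u2 ?eqxx //.
  by case: Hu => ->; rewrite i0E /cdist /=; lia.
rewrite rcons_path size_rcons last_rcons => /andP[/IH H s]; exact: reached_step s H.
Qed.

(** A simple path stays in the component of [u], hence has fewer than [L] steps. The resulting chain
    has at least [f v.2] links, and is truncated to exactly that number so that the union bound runs
    over tuples of fixed length. *)
Lemma connect_chain (f : X -> nat) (u v : point X M) L :
  (forall a b, ed a b -> (f a <= (f b).+1)%N && (f b <= (f a).+1)%N) -> f o = 0%N ->
  u = (ord0, o) \/ u = (ord_max, o) -> connect (symrel r) u v ->
  (#|connect (symrel r) u| <= L)%N ->
  exists c : (f v.2).-tuple ('I_M * (X * X)),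
    [/\ path next t0 c, uniq (map fst c), all (occupied w) c & (cost 0 c <= 2 * L)%N].
Proof.
move=> Hf fo Hu /connectP[p0 p0p ->] cL.
case/shortenP: p0p => p pp up _.
have sp : (size p < L)%N.
  apply: leq_trans cL; rewrite -[(size p).+1]/(size (u :: p)) -(card_uniqP up).
  by apply: subset_leq_card; apply/fintype.subsetP => z; apply: (path_connect pp).
have u2 : u.2 = o by case: Hu => ->.
have [c [pc uc oc tc cc]] := reached_path u2 Hu pp.
have fc : (f (last u p).2 <= size c)%N.
  rewrite -[size c]add0n; apply: (chain_touch Hf _ pc tc) => z.
  by rewrite /touch orbb => /eqP->; rewrite fo.
have ct : size (take (f (last u p).2) c) == f (last u p).2 by rewrite size_takel.
exists (Tuple ct); rewrite /= -(cat_take_drop (f (last u p).2) c) in pc uc oc cc *.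
move: pc uc oc cc; rewrite take_size_cat ?(eqP ct) //.
rewrite cat_path map_cat cat_uniq all_cat cost_cat.
move=> /andP[-> _] /andP[-> _] /andP[-> _] cc; split=> //.
apply: (@leq_trans (2 * size p)); last by rewrite leq_mul2l /= ltnW.
by apply: leq_trans cc; rewrite -addnA leq_addr.
Qed.

End Extract.

(** * Counting chains of links *)

Section Union.
Variables (R : realType) (kappa : R) (D : nat).
Hypothesis kappa_gt0 : 0 < kappa.
Hypothesis deg : forall e : X * X,
  (#|[pred e' : X * X | ed e'.1 e'.2 && share e e']| <= D)%N.

(** At most four slots lie at a given distance from [j]: two sides, and two ways round the circle.
    The rest is a geometric series. *)
Lemma sum_cdist_le (j : 'I_M) :
  \sum_(i < M) expR (- kappa * (cdist j i)%:R) <= 4 / (1 - expR (- kappa)).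
Proof.
have q1 : expR (- kappa) < 1 by rewrite expR_lt1 oppr_lt0.
have geo n : \sum_(i < n) expR (- kappa) ^+ i <= 1 / (1 - expR (- kappa)).
  rewrite ler_pdivlMr ?subr_gt0 // mulrC.
  have := subrX1 (expR (- kappa)) n => E.
  have -> : (1 - expR (- kappa)) * \sum_(i < n) expR (- kappa) ^+ i = 1 - expR (- kappa) ^+ n.
    by rewrite -[1 - _ in LHS]opprB mulNr -E opprB.
  by rewrite gerBl exprn_ge0 ?expR_ge0.
pose phi (i : 'I_M) : 'I_M.+1 := inord (cdist j i).
have phiE i : (phi i : nat) = cdist j i by rewrite inordK // /cdist; have := ltn_ord j; lia.
apply: (@le_trans _ _ (#|{: bool * bool}|%:R * \sum_(v < M.+1) expR (- kappa) ^+ v)).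
  apply: (@ler_sum_inj _ _ _ _ _ _ _ _ phi
    (fun i => ((i <= j)%N, (maxn j i - minn j i <= M - (maxn j i - minn j i))%N))).
  - by move=> v _; rewrite exprn_ge0 ?expR_ge0.
  - by [].
  - by move=> i _; rewrite phiE expRM_natr.
  - move=> i i' _ _ [] /(congr1 val) /=; rewrite -!/(nat_of_ord _) !phiE => e e1 e2.
    apply: val_inj => /=; move: e e1 e2; rewrite /cdist.
    by have := ltn_ord i; have := ltn_ord i'; have := ltn_ord j; lia.
rewrite card_prod card_bool -[(2 * 2)%N]/4%N ler_wpM2l ?ler0n //.
by have := geo M.+1; rewrite div1r.
Qed.

(** Induction on the length: the next pair has at most [D] choices, and its slot contributes the sum
    of [sum_cdist_le]. *)
Lemma sum_chains_le n (t : 'I_M * (X * X)) :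
  \sum_(c : n.-tuple ('I_M * (X * X)) | path next t c) expR (- kappa * (cost t.1 c)%:R)
    <= (D%:R * (4 / (1 - expR (- kappa)))) ^+ n.
Proof.
have q1 : expR (- kappa) < 1 by rewrite expR_lt1 oppr_lt0.
have B0 : 0 <= 4 / (1 - expR (- kappa)) by rewrite divr_ge0 ?ler0n // subr_ge0 ltW.
elim: n t => [|n IH] t.
  rewrite expr0 big_mkcond (eq_bigr (fun=> 1)); last first.
    by move=> c _; rewrite (tuple0 c) /= mulr0 expR0.
  by rewrite sumr_const card_tuple expn0.
rewrite big_mkcond big_tuple_cons /= exprS.
set B := D%:R * _; have BB : 0 <= B by rewrite mulr_ge0 ?ler0n.
apply: (@le_trans _ _ (\sum_(t' | next t t') expR (- kappa * (cdist t.1 t'.1)%:R) * B ^+ n)).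
  rewrite [leRHS]big_mkcond; apply: ler_sum => t' _.
  case: ifP => nt; last by rewrite big1.
  rewrite -big_mkcond /=; apply: le_trans (ler_wpM2l (expR_ge0 _) (IH t')).
  rewrite mulr_sumr; apply: ler_sum => c _.
  by rewrite natrD mulrDr expRD.
rewrite -mulr_suml ler_wpM2r ?exprn_ge0 //.
rewrite (eq_bigl (fun t' : 'I_M * (X * X) => true && (ed t'.2.1 t'.2.2 && share t.2 t'.2))) //.
rewrite -(pair_big xpredT (fun e : X * X => ed e.1 e.2 && share t.2 e)
    (fun (i : 'I_M) e => expR (- kappa * (cdist t.1 i)%:R))) /=.
rewrite (eq_bigr (fun i : 'I_M => D%:R * expR (- kappa * (cdist t.1 i)%:R) -
   (D%:R - #|[pred e' : X * X | ed e'.1 e'.2 && share t.2 e']|%:R) * expR (- kappa * (cdist t.1 i)%:R))); last first.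
  move=> i _; rewrite sumr_const -[LHS]mulr_natl.
  rewrite -mulrBl; congr (_ * _); rewrite opprB addrC subrK; by [].
apply: (@le_trans _ _ (\sum_(i < M) D%:R * expR (- kappa * (cdist t.1 i)%:R))).
  by apply: ler_sum => i _; rewrite gerBl mulr_ge0 ?expR_ge0 // subr_ge0 ler_nat.
by rewrite -mulr_sumr ler_wpM2l ?ler0n // sum_cdist_le.
Qed.

End Union.
End Chains.

(** * Decay for a fixed number of time slots *)

Section DiscreteBound.
Variables (R : realType) (X : finType) (m M : nat) (ed : rel X) (i0 : 'I_M).
Hypothesis i0E : (i0 : nat) = 0%N.
Hypothesis ed_irr : forall a b, ed a b -> a != b.
Variables (o x : X) (f : X -> nat) (D : nat).
Hypothesis ox : o != x.
Hypothesis f_lip : forall a b, ed a b -> (f a <= (f b).+1)%N && (f b <= (f a).+1)%N.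
Hypothesis f_o : f o = 0%N.
Hypothesis deg : forall e : X * X,
  (#|[pred e' : X * X | ed e'.1 e'.2 && share e e']| <= D)%N.
Variables (eta : point X M -> R) (eta0 : R).
Hypothesis eta_ge0 : forall v, 0 <= eta v.
Hypothesis eta0_ge0 : 0 <= eta0.
Hypothesis eta_ge : forall k y, eta0 <= eta (before k, y).
Variables (wt : link X -> R) (delta kappa : R).
Hypothesis wt_ge0 : forall l, 0 <= wt l.
Hypothesis wt0_gt0 : 0 < wt None.
Hypothesis wt_invalid : forall l, ~~ valid_link ed l -> wt l = 0.
Hypothesis wt_edge : forall e, weight_of_edge wt e <= delta.
Hypothesis kappa_gt0 : 0 < kappa.
Let t0 : 'I_M * (X * X) := (i0, (o, o)).

(** Let [A] count the points of [K] below the last level. That level repeats level [0] except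
    possibly at [o] and [x], so it has at most [A + 2] points and [#|K| <= 2 * A + 2]; each point
    counted by [A] carries at least [eta0]. *)
Lemma sum_component_ge (K : pred (point X M)) L :
  (forall y, y != o -> y != x -> K (ord_max, y) -> K (ord0, y)) ->
  (L < #|K|)%N ->
  eta0 * (L%:R - 2) / 2 <= \sum_(v | K v) eta v.
Proof.
move=> Kc LK; pose A := (\sum_(k < M) \sum_(y | K (before k, y)) 1)%N.
have card_le : (#|K| <= 2 * A + 2)%N.
  rewrite -sum1_card (eq_bigl K) //.
  rewrite (eq_bigl (fun v : point X M => true && K (v.1, v.2))); last by case.
  rewrite -(pair_big_dep xpredT (fun i y => K (i, y)) (fun _ _ => 1%N)) /=.
  rewrite big_ord_recr /= -/A.
  suff : (\sum_(y | K (ord_max, y)) 1 <= A + 2)%N by lia.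
  apply: (@leq_trans (\sum_(y | K (ord0, y)) 1 + 2)%N); last first.
    rewrite leq_add2r /A (bigD1 i0) //=.
    have -> : before i0 = ord0 by apply: val_inj.
    exact: leq_addr.
  rewrite [leqLHS]big_mkcond [X in (_ <= X + _)%N]big_mkcond /=.
  have -> : 2%N = (\sum_y ((y == o) + (y == x)))%N.
    have one (z : X) : (\sum_y (y == z) = 1)%N.
      by rewrite (bigD1 z) //= eqxx big1 // => y /negbTE->.
    by rewrite big_split /= !one.
  rewrite -big_split /=; apply: leq_sum => y _.
  case: (boolP (K (ord_max, y))) => // Ky; case: eqP => [_|/eqP yo]; first lia.
  by case: eqP => [_|/eqP yx]; [lia | rewrite Kc].
apply: (@le_trans _ _ (eta0 * A%:R)).
  rewrite -mulrA ler_wpM2l // ler_pdivrMr ?ltr0n // lerBlDr -natrM -natrD ler_nat.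
  by move: LK card_le; lia.
rewrite (eq_bigl (fun v : point X M => true && K (v.1, v.2))); last by case.
rewrite (eq_bigr (fun v : point X M => eta (v.1, v.2))); last by case.
rewrite -(pair_big_dep xpredT (fun i y => K (i, y)) (fun i y => eta (i, y))) /=.
rewrite big_ord_recr /=; apply: (@le_trans _ _
   (\sum_(k < M) \sum_(y | K (before k, y)) eta (before k, y))); last first.
  by rewrite lerDl sumr_ge0.
rewrite /A natr_sum mulr_sumr; apply: ler_sum => k _.
by rewrite natr_sum mulr_sumr; apply: ler_sum => y _; rewrite mulr1.
Qed.

Definition short_chain L (c : seq ('I_M * (X * X))) : bool :=
  [&& path (next ed) t0 c, uniq (map fst c) & (cost 0 c <= 2 * L)%N].
Definition bad L (w : {ffun 'I_M -> link X}) : bool :=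
  [exists c : (f x).-tuple ('I_M * (X * X)), short_chain L c && all (occupied w) c].

(** A component with more than [L] points yields the exponential gain; a smaller one contains a
    short chain from [o] to [x], and then the trivial gain [1] is used. *)
Lemma Zcut_le_bad L (w : {ffun 'I_M -> link X}) : (forall k, valid_link ed (w k)) ->
  Zcut m w o x eta <=
    (2 * m.+1)%:R * ((expR (- (eta0 * (L%:R - 2) / 2)) + (bad L w)%:R) * Zlink m eta w).
Proof.
move=> wv; apply: (Zcut_le m ed_irr wv ox eta_ge0).
  by rewrite addr_ge0 ?expR_ge0 ?ler0n.
move=> u Hu cu; set r := strel _ _ in cu *.
have [] := leqP #|connect (symrel r) u| L => LK.
  have -> : bad L w.
    apply/existsP.
    have [v [vx cv]] : exists v : point X M, v.2 = x /\ connect (symrel r) u v.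
      by case/orP: cu; [exists (ord0, x)|exists (ord_max, x)].
    have [c [pc uc oc cc]] := connect_chain i0E wv f_lip f_o Hu cv LK.
    move: c pc uc oc cc; rewrite vx => c pc uc oc cc.
    by exists c; rewrite /short_chain pc uc cc oc.
  apply: (@le_trans _ _ 1); last by rewrite lerDr expR_ge0.
  by rewrite expR_le1 oppr_le0 sumr_ge0.
apply: (@le_trans _ _ (expR (- (eta0 * (L%:R - 2) / 2)))); last by rewrite lerDl ler0n.
rewrite ler_expR lerN2; apply: sum_component_ge => // y yo yx cy.
apply: connect_trans cy _; apply: connect1.
by rewrite /symrel /r /strel /= !eqxx (negbTE yo) (negbTE yx) /= orbT.
Qed.

(** Union bound over short chains. The constraint on the cost is relaxed as in Chernoff's
    inequality, through the factor [e^(kappa (2 L - cost))], which is at least one on short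
    chains. *)
Lemma sum_bad_le L :
  \sum_(w | bad L w) Wlink wt w * Zlink m eta w <=
  ((2 * m.+1)%:R * delta / wt None * (D%:R * (4 / (1 - expR (- kappa))))) ^+ f x
    * expR (kappa * (2 * L)%:R) * \sum_w Wlink wt w * Zlink m eta w.
Proof.
have WZ0 (w : {ffun 'I_M -> link X}) : 0 <= Wlink wt w * Zlink m eta w.
  by rewrite mulr_ge0 // ?Zlink_ge0 //; apply: Wlink_ge0.
apply: (@le_trans _ _ (\sum_(c : (f x).-tuple ('I_M * (X * X)) | short_chain L c)
   \sum_(w | all (occupied w) c) Wlink wt w * Zlink m eta w)).
  rewrite (exchange_big_dep xpredT) //= big_mkcond; apply: ler_sum => w _.
  case: ifP => [/existsP[c /andP[sc oc]]|_]; last by apply: sumr_ge0.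
  by rewrite (bigD1 c) ?sc ?oc //= lerDl sumr_ge0.
have q0 : 0 <= (2 * m.+1)%:R * delta / wt None.
  rewrite !mulr_ge0 ?ler0n ?invr_ge0 ?(ltW wt0_gt0) //.
  by apply: le_trans (wt_edge (o, o)); rewrite addr_ge0.
set S := \sum_w _; have S0 : 0 <= S by apply: sumr_ge0.
apply: (@le_trans _ _ (\sum_(c : (f x).-tuple ('I_M * (X * X)) | path (next ed) t0 c)
   ((2 * m.+1)%:R * delta / wt None) ^+ f x * expR (kappa * (2 * L)%:R) * S
     * expR (- kappa * (cost 0 c)%:R))).
  rewrite big_mkcond [leRHS]big_mkcond; apply: ler_sum => c _.
  case: ifP => [/and3P[-> uc cc]|_]; last first.
    by case: ifP => // _; rewrite !mulr_ge0 ?exprn_ge0 ?expR_ge0.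
  apply: le_trans (sum_occupied_le m eta_ge0 wt_ge0 wt0_gt0 wt_edge uc) _.
  rewrite size_tuple -/S [leRHS]mulrAC ler_wpM2r // -[leRHS]mulrA ler_peMr ?exprn_ge0 //.
  by rewrite -expRD mulNr -mulrBr -[leLHS]expR0 ler_expR mulr_ge0 ?(ltW kappa_gt0) // subr_ge0 ler_nat.
rewrite -mulr_sumr.
have H := sum_chains_le kappa_gt0 deg (f x) t0; rewrite /= i0E in H.
apply: le_trans (ler_wpM2l _ H) _; first by rewrite !mulr_ge0 ?exprn_ge0 ?expR_ge0.
rewrite [in leRHS]exprMn le_eqVlt; apply/orP; left; apply/eqP.
by rewrite mulrAC -!mulrA; congr (_ * _); rewrite mulrCA.
Qed.

Lemma sum_Zcut_le L :
  \sum_w Wlink wt w * Zcut m w o x eta <=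
  (2 * m.+1)%:R * (expR (- (eta0 * (L%:R - 2) / 2)) +
   ((2 * m.+1)%:R * delta / wt None * (D%:R * (4 / (1 - expR (- kappa))))) ^+ f x
    * expR (kappa * (2 * L)%:R)) * \sum_w Wlink wt w * Zlink m eta w.
Proof.
set e1 := expR (- _).
apply: (@le_trans _ _ (\sum_w (2 * m.+1)%:R *
   (e1 * (Wlink wt w * Zlink m eta w) + (bad L w)%:R * (Wlink wt w * Zlink m eta w)))).
  apply: ler_sum => w _; case: (boolP [forall k, valid_link ed (w k)]) => [/forallP wv|].
    have W0 : 0 <= Wlink wt w by apply: Wlink_ge0.
    apply: le_trans (ler_wpM2l W0 (Zcut_le_bad L wv)) _; rewrite -/e1.
    by rewrite le_eqVlt; apply/orP; left; apply/eqP; ring.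
  (* A sequence with a pair that is not an edge has weight zero. *)
  case/forallPn => k nk; have -> : Wlink wt w = 0.
    by rewrite /Wlink (bigD1 k) //= wt_invalid // mul0r.
  by rewrite !mul0r !mulr0 addr0 mulr0.
rewrite -mulr_sumr -mulrA ler_wpM2l ?ler0n // big_split /= -mulr_sumr mulrDl lerD2l.
apply: le_trans (sum_bad_le L).
rewrite [leRHS]big_mkcond; apply: ler_sum => w _.
by case: (bad L w); rewrite ?mul1r ?mul0r.
Qed.

End DiscreteBound.

(** * Traces as sums over links *)

Section PathSum.
Variables (R : realType) (T : finType).

Definition kmx (P : T -> T -> R) : 'M[R]_#|T| := \matrix_(i, j) P (enum_val i) (enum_val j).

Lemma sum_enum_rank (F : 'I_#|T| -> R) : \sum_i F i = \sum_(s : T) F (enum_rank s).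
Proof. by rewrite (reindex _ (onW_bij _ (@enum_rank_bij T))). Qed.

Definition ffcons n (a : T) (q : {ffun 'I_n -> T}) : {ffun 'I_n.+1 -> T} :=
  [ffun i => if unlift ord0 i is Some j then q j else a].

Lemma ffcons0 n a (q : {ffun 'I_n -> T}) : ffcons a q ord0 = a.
Proof. by rewrite ffunE unlift_none. Qed.

Lemma ffconsS n a (q : {ffun 'I_n -> T}) j : ffcons a q (lift ord0 j) = q j.
Proof. by rewrite ffunE liftK. Qed.

Lemma big_ffun_cons n (F : {ffun 'I_n.+1 -> T} -> R) :
  \sum_p F p = \sum_a \sum_(q : {ffun 'I_n -> T}) F (ffcons a q).
Proof.
rewrite pair_big /= (reindex (fun p : T * {ffun 'I_n -> T} => ffcons p.1 p.2)) //=.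
exists (fun p : {ffun 'I_n.+1 -> T} => (p ord0, [ffun j => p (lift ord0 j)])).
  by move=> [a q] _ /=; rewrite ffcons0; congr (_, _); apply/ffunP => j; rewrite ffunE ffconsS.
move=> p _; apply/ffunP => i /=; case: (unliftP ord0 i) => [j|] ->; last by rewrite ffcons0.
by rewrite ffconsS ffunE.
Qed.

Lemma kmxX (P : T -> T -> R) M s t :
  (kmx P ^+ M) (enum_rank s) (enum_rank t) =
  \sum_(p : {ffun 'I_M.+1 -> T} | (p ord0 == s) && (p ord_max == t))
    \prod_k P (p (before k)) (p (after k)).
Proof.
elim: M s => [|M IH] s.
  rewrite expr0 mxE (inj_eq enum_rank_inj) big_mkcond big_ffun_cons (bigD1 s) //=.
  have e (i : 'I_1) : i = ord0 by apply: val_inj; case: i => -[].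
  pose q0 : {ffun 'I_0 -> T} := [ffun j : 'I_0 => s].
  have q0E q : q = q0 by apply/ffunP => -[].
  rewrite [X in _ = _ + X]big1 ?addr0; last first.
    by move=> a /negbTE as'; rewrite big1 // => q _; rewrite ffcons0 as'.
  rewrite (bigD1 q0) //= [X in _ = _ + X]big1 ?addr0; last first.
    by move=> q; rewrite (q0E q) eqxx.
  rewrite [ord_max](e ord_max) ffcons0 eqxx /= big_ord0; by case: eqP.
rewrite exprS mxE sum_enum_rank.
have fact : forall r, kmx P (enum_rank s) (enum_rank r) = P s r by move=> r; rewrite mxE !enum_rankK.
under eq_bigr => r _ do rewrite fact IH mulr_sumr.
rewrite [RHS]big_mkcond [RHS]big_ffun_cons [RHS](bigD1 s) //= [X in _ = _ + X]big1 ?addr0; last first.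
  by move=> a /negbTE as'; rewrite big1 // => q _; rewrite ffcons0 as'.
under [RHS]eq_bigr => q _.
  rewrite ffcons0 eqxx /=.
  have -> : ord_max = lift ord0 ord_max :> 'I_M.+2 by apply: val_inj.
  rewrite ffconsS.
  over.
rewrite -big_mkcond [RHS](partition_big (fun q : {ffun 'I_M.+1 -> T} => q ord0) xpredT) //=.
apply: eq_bigr => r _; apply: eq_big => [q|q /andP[/eqP q0 _]]; first by rewrite andbC.
rewrite big_ord_recl.
have -> : before (ord0 : 'I_M.+1) = ord0 by apply: val_inj.
rewrite ffcons0 /after ffconsS q0; congr (_ * _); apply: eq_bigr => k _.
have -> : before (lift ord0 k) = lift ord0 (before k) :> 'I_M.+2 by apply: val_inj.
by rewrite !ffconsS.
Qed.

Lemma trace_kmxX (O P : T -> T -> R) M :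
  \tr (kmx O *m kmx P ^+ M) =
  \sum_(p : {ffun 'I_M.+1 -> T}) O (p ord_max) (p ord0) * \prod_k P (p (before k)) (p (after k)).
Proof.
rewrite /mxtrace sum_enum_rank.
under eq_bigr => s _ do rewrite mxE sum_enum_rank.
under eq_bigr => s _ do under eq_bigr => t _ do rewrite kmxX mxE !enum_rankK mulr_sumr.
rewrite [RHS](partition_big (fun p : {ffun 'I_M.+1 -> T} => p ord_max) xpredT) //=.
apply: eq_bigr => s _.
rewrite [RHS](partition_big (fun p : {ffun 'I_M.+1 -> T} => p ord0) xpredT) //=.
apply: eq_bigr => t _; apply: eq_big => [p|p /andP[/eqP-> /eqP->]] //.
by rewrite andbC.
Qed.

End PathSum.

(** * Expansion of the trace over links and space-time configurations *)

Section TraceLinks.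
Variables (R : realType) (X : finType) (m M : nat) (wt : link X -> R) (g : X -> R).
Local Notation conf := {ffun X -> 'I_m.+1}.

Definition field_energy (s : conf) : R := \sum_y g y * spin_val R (s y).
Definition kernel (s t : conf) : R :=
  expR (field_energy s) * \sum_(l : link X) wt l * (step l s t)%:R.
(* Level [M] is a copy of level [0], so it carries no weight of its own. *)
Definition field_eta (v : point X M) : R := if v.1 == ord_max then 0 else g v.2.

(** Distributing the product over the slots selects one link in each, and a path of configurations
    is read as a single spin function on space-time. *)
Lemma trace_links (O : conf -> conf -> R) :
  \tr (kmx O *m kmx kernel ^+ M) =
  \sum_w Wlink wt w *
    \sum_(s : {ffun point X M -> 'I_m.+1} |
            [forall k, step (w k) (slice s (before k)) (slice s (after k))])
      O (slice s ord_max) (slice s ord0) * weight field_eta s.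
Proof.
rewrite trace_kmxX.
rewrite (reindex (fun s : {ffun point X M -> 'I_m.+1} => [ffun i => slice s i])) /=; last first.
  exists (fun p : {ffun 'I_M.+1 -> conf} => [ffun v : point X M => p v.1 v.2]).
    by move=> s _; apply/ffunP => -[i y]; rewrite !ffunE.
  by move=> p _; apply/ffunP => i; apply/ffunP => y; rewrite !ffunE.
under eq_bigr => s _.
  have -> : \prod_k kernel ([ffun i => slice s i] (before k)) ([ffun i => slice s i] (after k)) =
    weight field_eta s * \sum_w Wlink wt w *
      [forall k, step (w k) (slice s (before k)) (slice s (after k))]%:R.
    rewrite /kernel big_split /= bigA_distr_bigA /=; congr (_ * _).
      rewrite -expR_sum /weight; congr expR.
      rewrite (eq_bigr (fun v : point X M => field_eta (v.1, v.2) * spin_val R (s (v.1, v.2)))); last by case.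
      rewrite -(pair_big xpredT xpredT (fun i y => field_eta (i, y) * spin_val R (s (i, y)))) /=.
      rewrite big_ord_recr /= [X in _ = _ + X]big1 ?addr0; last first.
        by move=> y _; rewrite /field_eta /= eqxx mul0r.
      apply: eq_bigr => k _; rewrite /field_energy; apply: eq_bigr => y _.
      rewrite !ffunE /field_eta /=.
      have -> : (widen_ord (leqnSn M) k == ord_max) = false.
        by apply/negbTE; rewrite -val_eqE /= neq_ltn ltn_ord.
      by [].
    apply: eq_bigr => w _; rewrite big_split /=; congr (_ * _).
    rewrite -natr_prod; congr (_%:R).
    case: forallP => [H|H].
      by apply: big1 => k _; rewrite !ffunE H.
    have /forallPn[k nk] : ~~ [forall k, step (w k) (slice s (before k)) (slice s (after k))].
      by apply/forallP.
    by rewrite (bigD1 k) //= !ffunE (negbTE nk) mul0n.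
  rewrite !ffunE mulrA mulr_sumr.
  over.
rewrite exchange_big /=; apply: eq_bigr => w _.
rewrite mulr_sumr [RHS]big_mkcond; apply: eq_bigr => s _.
by case: ifP => _; rewrite ?mulr0 // mulr1 mulrC.
Qed.

End TraceLinks.

(** * Splitting off the field in a time slice *)

Section FieldTrotter.
Variable R : realType.

Lemma expR_taylor2 (t : R) : `|t| <= 2^-1 -> 0 <= expR t - 1 - t <= 2 * t ^+ 2.
Proof.
move=> tb; have /andP[t1 t2] : - 2^-1 <= t <= 2^-1 by rewrite -ler_norml.
have e1 := expR_ge1Dx t; have e2 := expR_ge1Dx (- t).
have e : expR t * (1 - t) <= 1.
  by rewrite -ler_pdivlMl ?expR_gt0 // mulr1 -expRN.
apply/andP; split; first by lra.
(* This is the surplus in [(1 - t) (1 + t + 2 t^2) = 1 + t^2 (1 - 2 t)]. *)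
have h : 0 <= t ^+ 2 * (1 - 2 * t) by rewrite mulr_ge0 ?sqr_ge0 //; lra.
have k : expR t <= 1 + t + 2 * t ^+ 2.
  have t3 : 0 < 1 - t by lra.
  rewrite -(ler_pM2r t3); apply: le_trans e _; lra.
lra.
Qed.

Lemma near_natr_ge (c : R) : \forall N \near (\oo)%classic, c <= N.+1%:R.
Proof.
exists (Num.truncn c) => //= N cN.
by apply: le_trans (ltW (truncnS_gt c)) _; rewrite ler_nat.
Qed.

(** With [t = (beta / (N+1)) f], the error is [(e^t - 1 - t)] on the diagonal plus [(e^t - 1)] times
    the coupling term, and both are of second order in the time step. *)
Lemma rowbnd_field n (K B : 'M[R]_n) (f : 'I_n -> R) (beta : R) (P : nat -> 'M[R]_n) :
  0 < beta ->
  (forall N i j, P N i j =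
     expR (beta / N.+1%:R * f i) * ((i == j)%:R + beta / N.+1%:R * K i j)) ->
  (forall i j, B i j = beta * (K i j + (i == j)%:R * f i)) ->
  exists C, \forall N \near (\oo)%classic,
    rowbnd (P N - (1 + N.+1%:R^-1 *: B)) (C / N.+1%:R ^+ 2).
Proof.
move=> b0 PE BE; have [k k0 Hk] := rowbnd_exists K.
pose fm := \sum_i `|f i|.
have fi i : `|f i| <= fm by rewrite /fm (bigD1 i) //= lerDl sumr_ge0.
have fm0 : 0 <= fm by apply: sumr_ge0.
exists (beta ^+ 2 * (2 * fm ^+ 2 + 2 * fm * k)).
apply: filterS (near_natr_ge (2 * beta * fm)) => N hN i.
set d := beta / N.+1%:R.
have N0 : 0 < N.+1%:R :> R by rewrite ltr0n.
have d0 : 0 <= d by rewrite divr_ge0 // ltW.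
have dfm : d * fm <= 2^-1.
  rewrite /d mulrAC ler_pdivrMr //; lra.
pose t := d * f i.
have tm : `|t| <= d * fm by rewrite normrM (ger0_norm d0) ler_wpM2l.
have /andP[t1 t2] := expR_taylor2 (le_trans tm dfm).
have tt : t ^+ 2 <= (d * fm) ^+ 2.
  by rewrite -(real_normK (num_real t)); apply: lerXn2r => //; rewrite nnegrE mulr_ge0.
have e2 : `|expR t - 1| <= 2 * (d * fm).
  have := ler_normD (expR t - 1 - t) t; rewrite subrK => /le_trans; apply.
  rewrite (ger0_norm t1).
  have : t ^+ 2 <= `|t| * 2^-1.
    rewrite -[t ^+ 2]ger0_norm ?sqr_ge0 // normrX expr2 ler_wpM2l //; exact: le_trans dfm.
  by move=> h; lra.
apply: (@le_trans _ _ (\sum_j ((i == j)%:R * (2 * (d * fm) ^+ 2) + 2 * (d * fm) * d * `|K i j|))).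
  apply: ler_sum => j _; rewrite !mxE PE BE -/d -/t.
  have -> : expR t * ((i == j)%:R + d * K i j) -
      ((i == j)%:R + N.+1%:R^-1 * (beta * (K i j + (i == j)%:R * f i))) =
      (i == j)%:R * (expR t - 1 - t) + (expR t - 1) * d * K i j.
    by rewrite /t /d; ring.
  apply: le_trans (ler_normD _ _) _; apply: lerD.
    rewrite normrM ger0_norm ?ler0n // ler_wpM2l ?ler0n // ger0_norm //.
    by apply: le_trans t2 _; rewrite ler_wpM2l.
  rewrite normrM [X in X * _]normrM (ger0_norm d0) ler_wpM2r // ler_wpM2r //.
rewrite big_split /= -mulr_suml -mulr_sumr.
have -> : \sum_j (i == j)%:R = 1 :> R.
  by rewrite (bigD1 i) //= eqxx big1 ?addr0 // => j; rewrite eq_sym => /negbTE->.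
rewrite mul1r; apply: (@le_trans _ _ (2 * (d * fm) ^+ 2 + 2 * (d * fm) * d * k)).
  by rewrite lerD2l; apply: ler_wpM2l; [exact: (mulr_ge0 (mulr_ge0 (ler0n _ 2) (mulr_ge0 d0 fm0)) d0)|exact: Hk].
rewrite le_eqVlt; apply/orP; left; apply/eqP; rewrite /d; field.
by rewrite gt_eqF.
Qed.

Lemma cvg_sum (I : Type) (r : seq I) (u : I -> nat -> R) (l : I -> R) :
  (forall i, (u i @ \oo --> l i)%classic) ->
  ((fun N => \sum_(i <- r) u i N) @ \oo --> \sum_(i <- r) l i)%classic.
Proof.
move=> H; elim: r => [|i r IH].
  rewrite big_nil; under eq_fun do rewrite big_nil; exact: cvg_cst.
by rewrite big_cons; under eq_fun do rewrite big_cons; apply: cvgD.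
Qed.

Lemma cvg_trace n (O E : 'M[R]_n) (A : nat -> 'M[R]_n) :
  (forall i j, ((fun N => A N i j) @ \oo --> E i j)%classic) ->
  ((fun N => \tr (O *m A N)) @ \oo --> \tr (O *m E))%classic.
Proof.
move=> H; have tr (X : 'M[R]_n) : \tr (O *m X) = \sum_i \sum_j O i j * X j i.
  by apply: eq_bigr => i _; rewrite mxE.
rewrite tr; under eq_fun do rewrite tr.
apply: cvg_sum => i; apply: cvg_sum => j; apply: cvgM => //; exact: cvg_cst.
Qed.

End FieldTrotter.

(** * The lattice *)

Section Lattice.
Variables (d l : nat).
Implicit Types (x y : site d l).

Definition edge x y : bool := nn x y && (enum_rank x < enum_rank y)%N.
Definition l1norm x : nat := (\sum_(i < d) absz (Defs.coord x i))%N.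

Lemma edge_irr x y : edge x y -> x != y.
Proof. by case/andP=> _ h; apply: contraTneq h => ->; rewrite ltnn. Qed.

Lemma coord_origin i : Defs.coord (origin d l) i = 0.
Proof. by rewrite /Defs.coord ffunE inordK ?subrr //; lia. Qed.

Lemma l1norm_origin : l1norm (origin d l) = 0%N.
Proof. by rewrite /l1norm big1 // => i _; rewrite coord_origin. Qed.

Lemma nn_sym x y : nn x y = nn y x.
Proof. by rewrite /nn; congr (_ == _); apply: eq_bigr => i _; rewrite -abszN opprB. Qed.

Lemma nn_coord x y i : nn x y -> (absz (Defs.coord x i - Defs.coord y i) <= 1)%N.
Proof. by move=> /eqP<-; rewrite (bigD1 i) //= leq_addr. Qed.

Lemma l1norm_nn x y : nn x y -> (l1norm x <= (l1norm y).+1)%N.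
Proof.
move=> /eqP h; rewrite -addn1 -h /l1norm -big_split /=.
by apply: leq_sum => i _; lia.
Qed.

Lemma l1norm_edge x y : edge x y ->
  (l1norm x <= (l1norm y).+1)%N && (l1norm y <= (l1norm x).+1)%N.
Proof. by case/andP=> h _; rewrite !l1norm_nn // nn_sym. Qed.

(** The coordinate differences of neighbours, shifted by one to lie in [{0, 1, 2}]. *)
Definition direction x y : {ffun 'I_d -> 'I_3} := [ffun i => inord (y i + 1 - x i)].

Lemma directionE x y i : nn x y -> (direction x y i + x i = y i + 1)%N.
Proof.
move=> /(nn_coord i); rewrite ffunE /Defs.coord => h.
by rewrite inordK; lia.
Qed.

(** An incident edge is encoded by which of its ends is shared, which end of [e] that is, and its
    direction. *)
Lemma card_incident (e : site d l * site d l) :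
  (#|[pred e' : site d l * site d l | edge e'.1 e'.2 && share e e']| <= 4 * 3 ^ d)%N.
Proof.
have -> : (4 * 3 ^ d = #|{: bool * bool * {ffun 'I_d -> 'I_3}}|)%N.
  by rewrite !card_prod card_bool card_ffun !card_ord.
pose F (e' : site d l * site d l) := (touch e e'.1,
   if touch e e'.1 then e'.1 == e.1 else e'.2 == e.1, direction e'.1 e'.2).
apply: (@leq_card_in _ _ F) => -[a b] [a' b'] /andP[/= /andP[n1 _] s1] /andP[/= /andP[n2 _] s2].
rewrite /F /= => -[t1 t2 t3].
have dir i : (b i + a' i = b' i + a i)%N.
  have := directionE i n1; have := directionE i n2; rewrite t3.
  move: (nat_of_ord (a i)) (nat_of_ord (b i)) (nat_of_ord (a' i)) (nat_of_ord (b' i)) => p q p' q'.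
  by lia.
have bit z z' : touch e z -> touch e z' -> (z == e.1) = (z' == e.1) -> z = z'.
  by rewrite /touch; case: (z =P e.1) => [->|_]; case: (z' =P e.1) => [->|_] //= /eqP-> /eqP->.
move: s1 s2; rewrite /share /= -t1; move: t2; rewrite -t1.
case: ifP => ta t2 /= s1 s2.
  have aa : a = a' by apply: bit => //; rewrite -t1.
  congr (_, _) => //; apply/ffunP => i; apply: val_inj; have := dir i; rewrite aa /=; lia.
have bb : b = b' by apply: bit.
congr (_, _) => //; apply/ffunP => i; apply: val_inj; have := dir i; rewrite bb /=; lia.
Qed.

Lemma eucl_norm_le (R : realType) x : eucl_norm R x <= (l1norm x)%:R.
Proof.
have sq (I : Type) (r : seq I) (F : I -> R) : (forall i, 0 <= F i) ->
    \sum_(i <- r) F i ^+ 2 <= (\sum_(i <- r) F i) ^+ 2.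
  move=> F0; elim: r => [|i r IH]; first by rewrite !big_nil expr0n.
  rewrite !big_cons sqrrD -addrA lerD2l; apply: le_trans IH _.
  by rewrite lerDr mulrn_wge0 // mulr_ge0 // sumr_ge0.
rewrite /eucl_norm -[leRHS]ger0_norm ?ler0n // -sqrtr_sqr ler_sqrt ?sqr_ge0 //.
rewrite natr_sum; apply: le_trans (sq _ _ _ _); last by move=> i; rewrite ler0n.
by apply: ler_sum => i _; rewrite -[X in X <= _]ger0_norm ?sqr_ge0 // normrX natr_absz intr_norm.
Qed.

Lemma l1norm_eq0 x : l1norm x = 0%N -> x = origin d l.
Proof.
move=> /eqP; rewrite sum_nat_eq0 => /forallP h; apply/ffunP => i; apply: val_inj.
have := h i; rewrite /= ffunE inordK /Defs.coord; lia.
Qed.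

(** Some coordinate is nonzero; it is moved one unit towards zero. *)
Lemma l1norm_descent x n : l1norm x = n.+1 -> exists2 y, nn x y & l1norm y = n.
Proof.
move=> e; have [i hi] : exists i, Defs.coord x i != 0.
  apply/existsP; apply: contraPT e => /existsPn h; rewrite /l1norm big1 // => i _.
  by have := h i; rewrite negbK => /eqP->.
pose v : nat := if (x i <= l)%N then (x i).+1 else (x i).-1.
have vl : (v < (2 * l).+1)%N.
  have := ltn_ord (x i); rewrite /v; move: hi; rewrite /Defs.coord; case: (leqP (x i) l); lia.
pose y : site d l := [ffun j => if j == i then Ordinal vl else x j].
have yi : y i = Ordinal vl by rewrite ffunE eqxx.
have yj j : j != i -> y j = x j by rewrite ffunE => /negbTE->.
exists y.
  rewrite /nn (bigD1 i) //= big1 => [|j ji].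
    rewrite /Defs.coord yi /= /v; move: hi; rewrite /Defs.coord; case: (leqP (x i) l); lia.
  by rewrite /Defs.coord yj // subrr.
apply: succn_inj; rewrite -e /l1norm (bigD1 i) //= [RHS](bigD1 i) //=.
have -> : (\sum_(j < d | j != i) absz (Defs.coord y j) = \sum_(j < d | j != i) absz (Defs.coord x j))%N.
  by apply: eq_bigr => j ji; rewrite /Defs.coord yj.
rewrite -addSn; congr (_ + _)%N; rewrite /Defs.coord yi /= /v; move: hi; rewrite /Defs.coord; case: (leqP (x i) l); lia.
Qed.

End Lattice.

(** * The Hamiltonian *)

Lemma big_option (R : realType) (T : finType) (F : option T -> R) :
  \sum_o F o = F None + \sum_t F (Some t).
Proof.
rewrite (bigD1 None) //=; congr (_ + _).
rewrite (reindex_omap Some id) //=; last by case.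
by apply: eq_bigl => t; rewrite eqxx.
Qed.

Section Kernel.
Variables (R : realType) (d l m : nat) (u : R) (h : site d l -> R).
Hypothesis u01 : 0 <= u <= 1.
Local Notation X := (site d l).

Definition nedges : R := \sum_(x : X) \sum_(y : X | edge x y) 1.
Definition coupling : Mx R d l m :=
  \sum_(x : X) \sum_(y : X | nn x y && (enum_rank x < enum_rank y)%N)
    (u *: T_op R m x y + (1 - u) *: Q_op R m x y - 1%:M).
Definition field (i : 'I_#|cfg d l m|) : R := \sum_y h y * spin_val R (enum_val i y).
(** The weights of one slot add up to one: the [-1] of every edge is collected in [None]. *)
Definition link_weight (delta : R) (o : link X) : R :=
  match o with
  | None => 1 - delta * nedges
  | Some (a, b, c) => if edge a b then delta * (if c then u else 1 - u) else 0
  end.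
Definition slice_mx (delta : R) : Mx R d l m :=
  kmx (kernel (link_weight delta) (fun y => delta * h y)).

Lemma slice_mxE delta i j :
  slice_mx delta i j = expR (delta * field i) * ((i == j)%:R + delta * coupling i j).
Proof.
rewrite mxE /kernel; congr (expR _ * _).
  by rewrite /field_energy /field mulr_sumr; apply: eq_bigr => y _; rewrite mulrA.
set s := enum_val i; set t := enum_val j.
have st : (s == t) = (i == j) by rewrite (inj_eq enum_val_inj).
rewrite big_option /= st.
have -> : coupling i j = \sum_(x : X) \sum_(y : X | edge x y)
    (u * (step (Some (x, y, true)) s t)%:R + (1 - u) * (step (Some (x, y, false)) s t)%:R - (i == j)%:R).
  rewrite /coupling summxE; apply: eq_bigr => x _; rewrite summxE.
  by apply: eq_bigr => y _; rewrite !mxE.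
have -> : \sum_(p : X * X * bool) link_weight delta (Some p) * (step (Some p) s t)%:R =
   \sum_(x : X) \sum_(y : X | edge x y)
     delta * (u * (step (Some (x, y, true)) s t)%:R + (1 - u) * (step (Some (x, y, false)) s t)%:R).
  rewrite (eq_bigr (fun p : X * X * bool =>
    link_weight delta (Some (p.1, p.2)) * (step (Some (p.1, p.2)) s t)%:R)); last by case.
  rewrite -(pair_big xpredT xpredT (fun p c =>
     link_weight delta (Some (p, c)) * (step (Some (p, c)) s t)%:R)) /=.
  rewrite (eq_bigr (fun p : X * X => \sum_(c : bool)
     link_weight delta (Some (p.1, p.2, c)) * (step (Some (p.1, p.2, c)) s t)%:R)); last by case.
  rewrite -(pair_big xpredT xpredT (fun x y => \sum_(c : bool)
     link_weight delta (Some (x, y, c)) * (step (Some (x, y, c)) s t)%:R)) /=.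
  apply: eq_bigr => x _; rewrite [RHS]big_mkcond; apply: eq_bigr => y _.
  rewrite big_bool /=; case: ifP => _; last by rewrite !mul0r addr0.
  by rewrite -!mulrA -mulrDr.
rewrite mulr_sumr mulrBl mul1r -addrA; congr (_ + _).
rewrite /nedges mulr_sumr mulr_suml addrC -sumrB; apply: eq_bigr => x _.
rewrite !mulr_sumr mulr_suml -sumrB; apply: eq_bigr => y _; ring.
Qed.

Lemma field_opE i j : (\sum_(x : X) h x *: S3_op R m x) i j = (i == j)%:R * field i.
Proof.
rewrite summxE /field mulr_sumr; apply: eq_bigr => x _; rewrite !mxE /S3_loc.
set s := enum_val i; set t := enum_val j.
have st : (s == t) = (i == j) by rewrite (inj_eq enum_val_inj).
rewrite -st; case: (s =P t) => [->|ne].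
  rewrite eqxx mul1r; have -> : agree_off t t (pred1 x).
    by apply/forallP => z; rewrite eqxx orbT.
  by rewrite mulr1 mul1r.
rewrite mul0r; case: (s x =P t x) => [e|_]; last by rewrite !mul0r mulr0.
have -> : agree_off s t (pred1 x) = false; last by rewrite !mulr0.
apply/negbTE/negP => /forallP H; apply: ne; apply/ffunP => z.
by have := H z; rewrite /=; case: eqP => [->|_ /eqP].
Qed.

Lemma hamiltonianE (beta : R) i j :
  (- beta *: hamiltonian m u h) i j = beta * (coupling i j + (i == j)%:R * field i).
Proof.
rewrite mxE -field_opE /hamiltonian -/coupling.
rewrite 3!mxE -/coupling; ring.
Qed.

Lemma slice_mx_cvg (beta : R) i j : 0 < beta ->
  ((fun N => (slice_mx (beta / N.+1%:R) ^+ N.+1) i j) @ \oo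
     --> expmx (- beta *: hamiltonian m u h) i j)%classic.
Proof.
move=> b0; have [C HC] := @rowbnd_field R _ coupling (- beta *: hamiltonian m u h) field beta
  (fun N => slice_mx (beta / N.+1%:R)) b0 (fun N => slice_mxE _) (hamiltonianE beta).
by rewrite mxE; apply: trotter HC.
Qed.

(** * Traces of powers of one time slice *)

Section Slice.
Variables (delta : R) (M : nat).
Hypothesis delta_ge0 : 0 <= delta.
Hypothesis delta_small : delta * nedges <= 2^-1.
Local Notation wt := (link_weight delta).
Local Notation eta := (field_eta (M := M) (fun y => delta * h y)).

Lemma link_weight_ge0 o : 0 <= wt o.
Proof.
case: o => [[[a b] c]|] /=; last by move: delta_small; lra.
case: ifP => // _; rewrite mulr_ge0 //; case/andP: u01 => *; case: c => //.
by rewrite subr_ge0.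
Qed.

Lemma link_weight0 : 2^-1 <= wt None.
Proof. by rewrite /=; move: delta_small; lra. Qed.

Lemma link_weight_edge e : weight_of_edge wt e <= delta.
Proof.
case: e => a b; rewrite /weight_of_edge /=; case: ifP => _; last by rewrite addr0.
by rewrite -mulrDr addrC subrK mulr1.
Qed.

Lemma link_weight_invalid o : ~~ valid_link (@edge d l) o -> wt o = 0.
Proof. by case: o => [[[a b] c]|] //= /negbTE->. Qed.

(** The trace inserts the identity kernel between the last and first levels, which closes the time
    circle above every site. *)
Lemma trace_slice_mx :
  \tr (slice_mx delta ^+ M) = \sum_w Wlink wt w * Zlink m eta w.
Proof.
have -> : slice_mx delta ^+ M = kmx (fun s t : cfg d l m => (s == t)%:R : R) *m slice_mx delta ^+ M.
  rewrite -[LHS]mul1mx; congr (_ *m _); apply/matrixP => i j.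
  by rewrite !mxE (inj_eq enum_val_inj).
rewrite trace_links; apply: eq_bigr => w _; congr (_ * _); rewrite /Zlink.
rewrite [LHS]big_mkcond [RHS]big_mkcond; apply: eq_bigr => s _.
case: (boolP (compat (strel w pred0) s)) => [/compat_strelP[H1 H2]|nc].
  rewrite ifT; last by apply/forallP.
  have -> : slice s ord_max = slice s ord0 by apply/ffunP => y; rewrite !ffunE H2.
  by rewrite eqxx mul1r.
case: ifP => // /forallP H; case: eqP => [e|_]; last by rewrite mul0r.
case/negP: nc; apply/compat_strelP; split=> // y _.
by move/ffunP/(_ y): e; rewrite !ffunE.
Qed.

Variable x : X.
Local Notation o := (origin d l).

Definition S1_kernel (z : X) (s t : cfg d l m) : R :=
  S1_loc R (s z) (t z) * (agree_off s t (pred1 z))%:R.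
Definition corr (s t : cfg d l m) : R := \sum_r S1_kernel o s r * S1_kernel x r t.
Definition S1_bound : R := \sum_(a < m.+1) \sum_(b < m.+1) S1_loc R a b.

Lemma corrE : S1_op R m o *m S1_op R m x = kmx corr.
Proof.
apply/matrixP => i j; rewrite !mxE /corr sum_enum_rank; apply: eq_bigr => r _.
by rewrite !mxE enum_rankK.
Qed.

Lemma S1_loc_ge0 a b : 0 <= S1_loc R (m := m) a b.
Proof. by rewrite /S1_loc; case: ifP => // _; rewrite divr_ge0 ?sqrtr_ge0. Qed.

Lemma S1_bound_ge0 : 0 <= S1_bound.
Proof. by do 2!apply: sumr_ge0 => ? _; apply: S1_loc_ge0. Qed.

Lemma S1_loc_le a b : S1_loc R (m := m) a b <= S1_bound.
Proof.
rewrite /S1_bound (bigD1 a) //= (bigD1 b) //= -addrA lerDl addr_ge0 //.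
  by apply: sumr_ge0 => ? _; apply: S1_loc_ge0.
by do 2!apply: sumr_ge0 => ? _; apply: S1_loc_ge0.
Qed.

Lemma S1_locxx a : S1_loc R (m := m) a a = 0.
Proof. by rewrite /S1_loc ifF // orbb; lia. Qed.

Lemma S1_kernel_ge0 z s t : 0 <= S1_kernel z s t.
Proof. by rewrite mulr_ge0 ?S1_loc_ge0 ?ler0n. Qed.

Lemma S1_kernel_le z s t :
  S1_kernel z s t <= S1_bound * (agree_off s t (pred1 z) && (s z != t z))%:R.
Proof.
rewrite /S1_kernel; case: agree_off; rewrite ?mulr0 //= mulr1.
by case: eqP => [->|_]; rewrite ?S1_locxx ?mulr0 // mulr1 S1_loc_le.
Qed.

(** For [o != x] each spin operator must change the spin at its own site; for [o = x] the second may
    undo the first, so nothing is required. *)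
Definition cut_pair (s t : cfg d l m) : bool :=
  [forall z, pred2 o x z || (s z == t z)] &&
  ((o != x) ==> (s o != t o) && (s x != t x)).

(** The diagonal of [S1_loc] vanishes, hence the inequalities at [o] and [x]. The intermediate
    configuration is determined by its spin at [o], hence the factor [m.+1]. *)
Lemma corr_le s t : corr s t <= S1_bound ^+ 2 * m.+1%:R * (cut_pair s t)%:R.
Proof.
have B0 := S1_bound_ge0.
pose g (r : cfg d l m) := [&& agree_off s r (pred1 o), s o != r o,
  agree_off r t (pred1 x) & r x != t x].
apply: (@le_trans _ _ (\sum_r S1_bound ^+ 2 * (g r)%:R)).
  apply: ler_sum => r _.
  apply: le_trans (ler_pM (S1_kernel_ge0 _ _ _) (S1_kernel_ge0 _ _ _)
     (S1_kernel_le _ _ _) (S1_kernel_le _ _ _)) _.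
  by rewrite mulrACA -expr2 -natrM mulnb -!andbA.
rewrite -mulr_sumr -mulrA ler_wpM2l ?exprn_ge0 //.
case: (boolP (cut_pair s t)) => [_|nc]; last first.
  rewrite big1 ?mulr0 // => r _; case: (boolP (g r)) => // /and4P[/forallP a1 n1 /forallP a2 n2].
  case/negP: nc; apply/andP; split.
    apply/forallP => z /=; have := a1 z; have := a2 z; rewrite /=.
    by case: (z =P x) => _; case: (z =P o) => //= _ /eqP<- /eqP->.
  apply/implyP => ox; have := a1 x; have := a2 o.
  have xo : (x == o) = false by rewrite eq_sym (negbTE ox).
  rewrite /= xo (negbTE ox) /=.
  by move=> /eqP<- /eqP->; rewrite n1 n2.
rewrite mulr1 -natr_sum ler_nat -big_mkcond sum1_card -[leqRHS]card_ord.
apply: (@leq_card_in _ _ (fun r : cfg d l m => r o)) => r r'.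
move=> /and4P[/forallP a1 _ _ _] /and4P[/forallP a2 _ _ _] e; apply/ffunP => z.
by have := a1 z; have := a2 z; rewrite /=; case: eqP => [->//|_ /= /eqP<- /eqP->].
Qed.

Lemma trace_corr_le :
  \tr (kmx corr *m slice_mx delta ^+ M) <= S1_bound ^+ 2 * m.+1%:R *
    \sum_w Wlink wt w * \sum_(s : {ffun point X M -> 'I_m.+1} |
        compat (strel w (pred2 o x)) s &&
        ((o != x) ==> (s (ord0, o) != s (ord_max, o)) && (s (ord0, x) != s (ord_max, x))))
      weight eta s.
Proof.
rewrite trace_links mulr_sumr; apply: ler_sum => w _; rewrite mulrCA.
apply: ler_wpM2l; first by apply: Wlink_ge0 => a; apply: link_weight_ge0.
rewrite mulr_sumr [leRHS]big_mkcond [leLHS]big_mkcond /=; apply: ler_sum => s _.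
have c0 : 0 <= S1_bound ^+ 2 * m.+1%:R.
  by rewrite mulr_ge0 ?ler0n // exprn_ge0 // S1_bound_ge0.
case: ifP => [/forallP H|_]; last first.
  by case: ifP => // _; rewrite mulr_ge0 ?expR_ge0.
apply: le_trans (ler_wpM2r (expR_ge0 _) (corr_le _ _)) _.
case: (boolP (cut_pair _ _)) => [/andP[/forallP c1 c2]|_]; last first.
  by rewrite mulr0 mul0r; case: ifP => // _; rewrite mulr_ge0 ?expR_ge0.
rewrite mulr1 ifT //; apply/andP; split.
  apply/compat_strelP; split=> // y ny; have := c1 y; rewrite !ffunE.
  by rewrite (negbTE ny) => /eqP.
by move: c2; rewrite !ffunE ![_ (ord0, _) == _]eq_sym.
Qed.

(** There is a single cut, and merging its two ends costs one factor [2 * m.+1]. *)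
Lemma trace_corr_diag : (forall y, 0 <= h y) -> o = x ->
  \tr (kmx corr *m slice_mx delta ^+ M) <= S1_bound ^+ 2 * m.+1%:R *
     (2 * m.+1)%:R * \tr (slice_mx delta ^+ M).
Proof.
move=> h0 ox; apply: le_trans trace_corr_le _; rewrite -[leRHS]mulrA.
apply: ler_wpM2l.
  by rewrite mulr_ge0 ?ler0n // exprn_ge0 // S1_bound_ge0.
rewrite trace_slice_mx mulr_sumr; apply: ler_sum => w _; rewrite mulrCA.
apply: ler_wpM2l; first by apply: Wlink_ge0 => a; apply: link_weight_ge0.
have eta0 v : 0 <= eta v by rewrite /field_eta; case: ifP => // _; rewrite mulr_ge0.
rewrite (eq_bigl (fun s => compat (strel w (pred2 o x)) s)); last first.
  by move=> s; rewrite -ox eqxx /= andbT.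
apply: le_trans (@sum_compat_merge R m _ (strel w (pred2 o x)) eta eta0 (ord0, o) (ord_max, o)) _.
apply: ler_wpM2l; first by rewrite ler0n.
rewrite /Zlink [leRHS]big_mkcond [leLHS]big_mkcond; apply: ler_sum => s _.
case: ifP => [/andP[/compat_strelP[H1 H2] /eqP e]|_]; last by case: ifP => // _; apply: expR_ge0.
rewrite ifT //; apply/compat_strelP; split=> // y _.
case: (boolP (pred2 o x y)) => [|/H2 //]; rewrite /= -ox orbb => /eqP->.
by rewrite e.
Qed.

End Slice.
End Kernel.

(** * Positivity *)

Section PositiveExponential.
Variables (R : realType) (n : nat).
Implicit Types (A K B : 'M[R]_n).

Definition nonneg_mx B : Prop := forall i j, 0 <= B i j.
Definition reach B i j : Prop := exists k, 0 < (B ^+ k) i j.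

Lemma nonneg_mxX B k : nonneg_mx B -> nonneg_mx (B ^+ k).
Proof.
move=> H; elim: k => [|k IH] i j; first by rewrite expr0 mxE ler0n.
by rewrite exprS mxE; apply: sumr_ge0 => a _; apply: mulr_ge0.
Qed.

Lemma reach_refl B i : reach B i i.
Proof. by exists 0%N; rewrite expr0 mxE eqxx. Qed.

Lemma reach1 B i j : 0 < B i j -> reach B i j.
Proof. by exists 1%N; rewrite expr1. Qed.

Lemma reach_trans B i j k : nonneg_mx B -> reach B i j -> reach B j k -> reach B i k.
Proof.
move=> H [a ha] [b hb]; exists (a + b)%N; rewrite exprD mxE (bigD1 j) //=.
apply: ltr_wpDr; last exact: mulr_gt0.
by apply: sumr_ge0 => c _; apply: mulr_ge0; apply: nonneg_mxX.
Qed.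

(** The slices [P2] treat the shift as a constant field: by [rowbnd_field] their powers tend to the
    exponential of [A], while the scalar factors come out exactly. Uniqueness of limits
    concludes. *)
Lemma exp_shift A K (beta c : R) i j : 0 < beta ->
  (forall a b, A a b = beta * (K a b - (a == b)%:R * c)) ->
  limn (fun N => exppart A N i j : R) =
    expR (- (beta * c)) * limn (fun N => exppart (beta *: K) N i j : R).
Proof.
move=> b0 AE.
pose P1 N : 'M[R]_n := 1 + N.+1%:R^-1 *: (beta *: K).
pose P2 N : 'M[R]_n := expR (- (beta * c) / N.+1%:R) *: P1 N.
have c1 : ((fun N => (P1 N ^+ N.+1) i j) @ \oo -->
    limn (fun N => exppart (beta *: K) N i j : R))%classic.
  apply: (@trotter _ _ _ _ 0); apply: nearW => N a.
  by rewrite subrr mul0r big1 // => b _; rewrite mxE normr0.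
have H1 N a b : P2 N a b =
    expR (beta / N.+1%:R * - c) * ((a == b)%:R + beta / N.+1%:R * K a b).
  rewrite !mxE; congr (expR _ * _); first by rewrite mulrN mulNr mulrAC.
  by congr (_ + _); rewrite mulrA [_^-1 * _]mulrC.
have H2 a b : A a b = beta * (K a b + (a == b)%:R * - c) by rewrite AE mulrN.
have [C HC] := rowbnd_field b0 H1 H2.
have c2 := @trotter _ _ A P2 C i j HC.
have E : (fun N => (P2 N ^+ N.+1) i j) = (fun N => expR (- (beta * c)) * (P1 N ^+ N.+1) i j).
  apply/funext => N; rewrite /P2 scalemxX mxE -expRM_natr; congr (expR _ * _).
  by rewrite divfK // pnatr_eq0.
rewrite E in c2.
have c3 : ((fun N => expR (- (beta * c)) * (P1 N ^+ N.+1) i j) @ \oo -->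
   expR (- (beta * c)) * limn (fun N => exppart (beta *: K) N i j : R))%classic.
  by apply: cvgM; [exact: cvg_cst|exact: c1].
have l2 := cvg_lim (@norm_hausdorff _ R) c2; have l3 := cvg_lim (@norm_hausdorff _ R) c3.
exact: (etrans (esym (l2 _)) (l3 _)).
Qed.

Lemma exp_ge_term B k i j : nonneg_mx B ->
  (k`!%:R)^-1 * (B ^+ k) i j <= limn (fun N => exppart B N i j : R).
Proof.
move=> H; apply: limr_ge; first exact: exppart_cvg.
exists k.+1 => //= N kN; rewrite /exppart summxE (bigD1 (Ordinal kN)) //= mxE lerDl.
by apply: sumr_ge0 => a _; rewrite mxE mulr_ge0 ?invr_ge0 ?ler0n //; apply: nonneg_mxX.
Qed.

Lemma exp_shift_gt0 A K (beta c : R) i j : 0 < beta -> nonneg_mx K ->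
  (forall a b, A a b = beta * (K a b - (a == b)%:R * c)) ->
  reach K i j -> 0 < limn (fun N => exppart A N i j : R).
Proof.
move=> b0 K0 AE [k hk]; rewrite (exp_shift i j b0 AE) mulr_gt0 ?expR_gt0 //.
have B0 : nonneg_mx (beta *: K) by move=> a b; rewrite mxE mulr_ge0 // ltW.
apply: lt_le_trans (exp_ge_term k i j B0).
by rewrite scalemxX mxE !mulr_gt0 ?invr_gt0 ?ltr0n ?fact_gt0 ?exprn_gt0.
Qed.

Lemma exp_shift_ge0 A K (beta c : R) i j : 0 < beta -> nonneg_mx K ->
  (forall a b, A a b = beta * (K a b - (a == b)%:R * c)) ->
  0 <= limn (fun N => exppart A N i j : R).
Proof.
move=> b0 K0 AE; rewrite (exp_shift i j b0 AE) mulr_ge0 ?expR_ge0 //.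
have B0 : nonneg_mx (beta *: K) by move=> a b; rewrite mxE mulr_ge0 // ltW.
apply: le_trans (exp_ge_term 0 i j B0).
by rewrite mulr_ge0 ?invr_ge0 ?ler0n //; apply: nonneg_mxX.
Qed.

End PositiveExponential.

(** * Moving excitations with [T] and [Q] links *)

Section Positivity.
Variables (R : realType) (d l m : nat) (u beta : R) (h : site d l -> R).
Hypothesis m_gt0 : (0 < m)%N.
Hypothesis u01 : 0 <= u <= 1.
Hypothesis beta_gt0 : 0 < beta.
Local Notation X := (site d l).
Local Notation o := (origin d l).
Local Notation E := (expmx (- beta *: hamiltonian m u h)).

(** The first term cancels the [-1] of every edge, the second makes the field part of the diagonal
    nonnegative. *)
Definition shift : R := nedges R d l + \sum_i `|@field R d l m h i|.
Definition shifted : Mx R d l m :=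
  \matrix_(i, j) (coupling d l m u i j + (i == j)%:R * (field h i + shift)).

Lemma shiftedE i j : shifted i j =
  \sum_(x : X) \sum_(y : X | edge x y)
    (u * (step (Some (x, y, true)) (enum_val i) (enum_val j))%:R +
     (1 - u) * (step (Some (x, y, false)) (enum_val i) (enum_val j))%:R)
  + (i == j)%:R * (field h i + \sum_k `|@field R d l m h k|).
Proof.
rewrite mxE /shift /coupling summxE [field h i + _]addrCA mulrDr addrA; congr (_ + _).
rewrite /nedges mulr_sumr -big_split /=; apply: eq_bigr => x _.
rewrite summxE mulr_sumr -big_split /=; apply: eq_bigr => y _.
by rewrite !mxE mulr1 subrK.
Qed.

Lemma shifted_diag_ge0 (i j : 'I_#|cfg d l m|) : 0 <= (i == j)%:R * (field h i + \sum_k `|@field R d l m h k|).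
Proof.
rewrite mulr_ge0 ?ler0n // (bigD1 i) //= addrA addr_ge0 ?sumr_ge0 //.
by rewrite -lerBlDl sub0r ler_normr lexx orbT.
Qed.

Lemma shifted_link_ge0 (x y : X) (s t : cfg d l m) :
  0 <= u * (step (Some (x, y, true)) s t)%:R + (1 - u) * (step (Some (x, y, false)) s t)%:R.
Proof. by case/andP: u01 => ? ?; rewrite addr_ge0 ?mulr_ge0 ?ler0n ?subr_ge0. Qed.

Lemma shifted_ge0 : nonneg_mx shifted.
Proof.
move=> i j; rewrite shiftedE addr_ge0 ?shifted_diag_ge0 //.
by do 2!apply: sumr_ge0 => ? _; apply: shifted_link_ge0.
Qed.

Lemma expmx_gt0 i j : reach shifted i j -> 0 < E i j.
Proof.
move=> r; rewrite mxE; apply: (exp_shift_gt0 beta_gt0 shifted_ge0 (c := shift) _ r) => a b.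
by rewrite hamiltonianE mxE; congr (_ * _); ring.
Qed.

Lemma expmx_ge0 i j : 0 <= E i j.
Proof.
rewrite mxE; apply: (exp_shift_ge0 (K := shifted) _ _ beta_gt0 shifted_ge0 (c := shift)) => a b.
by rewrite hamiltonianE mxE; congr (_ * _); ring.
Qed.

Definition creach (s t : cfg d l m) : Prop := reach shifted (enum_rank s) (enum_rank t).

Lemma creach_trans s t r : creach s t -> creach t r -> creach s r.
Proof. by apply: reach_trans; apply: shifted_ge0. Qed.

Lemma creach_link (x y : X) s t : edge x y ->
  0 < u * (step (Some (x, y, true)) s t)%:R + (1 - u) * (step (Some (x, y, false)) s t)%:R ->
  creach s t.
Proof.
move=> xy pos; apply: reach1; rewrite shiftedE !enum_rankK (bigD1 x) //= (bigD1 y) //=.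
apply: ltr_wpDr; first exact: shifted_diag_ge0.
apply: ltr_wpDr.
  by do 2!apply: sumr_ge0 => ? _; apply: shifted_link_ge0.
apply: ltr_wpDr; first by apply: sumr_ge0 => ? _; apply: shifted_link_ge0.
exact: pos.
Qed.

Lemma nn_edge (x y : X) : nn x y -> edge x y || edge y x.
Proof.
move=> xy; rewrite /edge xy nn_sym xy /=.
have : x != y by apply: contraTneq xy => ->; rewrite /nn big1 // => i _; rewrite subrr.
by move=> ne; have := inj_eq (@enum_rank_inj X) x y; rewrite (negbTE ne) -val_eqE /= => /negbT; rewrite neq_ltn.
Qed.

Lemma creach_T (x y : X) (s t : cfg d l m) : 0 < u -> nn x y -> s x = t y -> s y = t x ->
  (forall z, z != x -> z != y -> s z = t z) -> creach s t.
Proof.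
case/andP: u01 => _ u1 u0 xy e1 e2 e.
have pos (a b : X) : ((a, b) = (x, y)) \/ ((a, b) = (y, x)) ->
   0 < u * (step (Some (a, b, true)) s t)%:R + (1 - u) * (step (Some (a, b, false)) s t)%:R.
  move=> ab; have -> : step (Some (a, b, true)) s t.
    case: ab => -[-> ->]; rewrite /= e1 e2 !eqxx /=; apply/forallP => z.
      by case: eqP => //= /eqP zx; case: eqP => //= /eqP zy; rewrite e.
    by case: eqP => //= /eqP zx; case: eqP => //= /eqP zy; rewrite e.
  by rewrite mulr1 ltr_pwDl // mulr_ge0 ?ler0n ?subr_ge0.
by case/orP: (nn_edge xy) => ed; apply: creach_link ed (pos _ _ _); [left|right].
Qed.

Lemma creach_Q (x y : X) (s t : cfg d l m) : u < 1 -> nn x y -> s x = s y -> t x = t y ->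
  (forall z, z != x -> z != y -> s z = t z) -> creach s t.
Proof.
case/andP: u01 => u0 _ u1 xy e1 e2 e.
have pos (a b : X) : ((a, b) = (x, y)) \/ ((a, b) = (y, x)) ->
   0 < u * (step (Some (a, b, true)) s t)%:R + (1 - u) * (step (Some (a, b, false)) s t)%:R.
  move=> ab; have -> : step (Some (a, b, false)) s t.
    case: ab => -[-> ->]; rewrite /= e1 e2 !eqxx /=; apply/forallP => z.
      by case: eqP => //= /eqP zx; case: eqP => //= /eqP zy; rewrite e.
    by case: eqP => //= /eqP zx; case: eqP => //= /eqP zy; rewrite e.
  by rewrite mulr1 ltr_wpDl ?mulr_ge0 ?ler0n // subr_gt0.
by case/orP: (nn_edge xy) => ed; apply: creach_link ed (pos _ _ _); [left|right].
Qed.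

(** All spins at the lowest value [-S], except on [P] where they are one unit higher. *)
Definition excited (P : pred X) : cfg d l m := [ffun z => if P z then inord 1 else ord0].

Lemma excitedE P z : excited P z = if P z then inord 1 else ord0.
Proof. by rewrite ffunE. Qed.

Lemma creach_hop (x : X) : 0 < u -> creach (excited (pred1 o)) (excited (pred1 x)).
Proof.
move=> u0; move: {2}(l1norm x) (erefl (l1norm x)) => n; elim: n x => [|n IH] x e.
  by rewrite (l1norm_eq0 e); apply: reach_refl.
have [y xy ey] := l1norm_descent e.
have ne : (x == y) = false by apply/eqP => E; move: e; rewrite E ey; lia.
apply: creach_trans (IH y ey) _; apply: (creach_T u0 xy);
  rewrite ?excitedE /= ?eqxx ?ne ?[y == x]eq_sym ?ne //.
by move=> z zx zy; rewrite !excitedE /= (negbTE zx) (negbTE zy).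
Qed.

(* Two [Q] links along a path [y'' - y' - y] move an excitation from [y''] to [y]. *)
Lemma creach_double_hop (xi : pred X) k (y : X) : u < 1 -> l1norm y = (2 * k)%N ->
  (forall z, (l1norm z <= 2 * k)%N -> ~~ xi z) ->
  creach (excited (predU xi (pred1 o))) (excited (predU xi (pred1 y))).
Proof.
move=> u1; elim: k y => [|k IH] y e hxi.
  by rewrite (l1norm_eq0 e); apply: reach_refl.
have e' : l1norm y = (2 * k).+2 by rewrite e mulnS.
have [y1 n1 e1] := l1norm_descent e'; have [y2 n2 e2] := l1norm_descent e1.
have y01 : (y == y1) = false by apply/eqP => E; move: e'; rewrite E; lia.
have y02 : (y == y2) = false by apply/eqP => E; move: e'; rewrite E; lia.
have y12 : (y1 == y2) = false by apply/eqP => E; move: e1; rewrite E; lia.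
have x0 : xi y = false by apply/negbTE/hxi; rewrite e.
have x1 : xi y1 = false by apply/negbTE/hxi; rewrite e1; lia.
have x2 : xi y2 = false by apply/negbTE/hxi; rewrite e2; lia.
apply: creach_trans (IH y2 e2 _) _; first by move=> z hz; apply: hxi; lia.
(* The first [Q] link creates a pair of excitations at [y] and [y1]; the second annihilates the pair
   at [y1] and [y2]. *)
pose full := excited (predU xi (pred3 y y1 y2)).
apply: (@creach_trans _ full).
  apply: (creach_Q u1 n1); rewrite ?/full ?excitedE /= ?x0 ?x1 ?y01 ?y02 ?y12 ?eqxx ?orbT //.
  by move=> z zx zy; rewrite !excitedE /= (negbTE zx) (negbTE zy).
apply: (creach_Q u1 n2); rewrite ?/full ?excitedE /= ?x1 ?x2 ?[y1 == y]eq_sym ?[y2 == y]eq_sym ?y01 ?y02 ?y12 ?eqxx ?orbT //.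
by move=> z zx zy; rewrite !excitedE /= (negbTE zx) (negbTE zy) !orbF.
Qed.

Lemma S1_loc01 (a b : 'I_m.+1) : (a = 0%N :> nat /\ b = 1%N :> nat) \/ (a = 1%N :> nat /\ b = 0%N :> nat) ->
  0 < S1_loc R a b.
Proof.
have m0 : 0 < m%:R :> R by rewrite ltr0n.
move=> H; rewrite /S1_loc ifT; last by case: H => -[-> ->].
rewrite divr_gt0 ?ltr0n // sqrtr_gt0 /spin_val /spinS.
by case: H => -[-> ->]; lra.
Qed.

Lemma S1_kernel_excited (z : X) (P Q : pred X) : P z != Q z ->
  (forall y, y != z -> P y = Q y) -> 0 < S1_kernel R z (excited P) (excited Q).
Proof.
move=> ne e; rewrite /S1_kernel; have -> : agree_off (excited P) (excited Q) (pred1 z).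
  by apply/forallP => y; case: (boolP (pred1 z y)) => //= yz; rewrite !excitedE e.
rewrite mulr1; apply: S1_loc01; rewrite !excitedE.
have i1 : (inord 1 : 'I_m.+1) = 1%N :> nat by rewrite inordK.
by case: (P z) ne; case: (Q z) => //= _; [right|left].
Qed.

Lemma corr_gt0 (x : X) (P Q S : pred X) :
  P o != Q o -> (forall y, y != o -> P y = Q y) ->
  Q x != S x -> (forall y, y != x -> Q y = S y) ->
  0 < corr R x (excited P) (excited S).
Proof.
move=> n1 e1 n2 e2; rewrite /corr (bigD1 (excited Q)) //=; apply: ltr_pwDl.
  by apply: mulr_gt0; apply: S1_kernel_excited.
by apply: sumr_ge0 => r _; rewrite mulr_ge0 ?S1_kernel_ge0.
Qed.

Lemma corr_ge0 (x : X) (s t : cfg d l m) : 0 <= corr R x s t.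
Proof. by apply: sumr_ge0 => r _; rewrite mulr_ge0 ?S1_kernel_ge0. Qed.

Lemma trace_corr_gt0_of (x : X) s t : 0 < corr R x s t -> creach t s ->
  0 < \tr (kmx (corr R (m := m) x) *m E).
Proof.
move=> c r; rewrite /mxtrace sum_enum_rank (bigD1 s) //=; apply: ltr_pwDl; last first.
  by apply: sumr_ge0 => i _; rewrite mxE; apply: sumr_ge0 => j _; rewrite mulr_ge0 ?expmx_ge0 // mxE corr_ge0.
rewrite mxE (bigD1 (enum_rank t)) //=; apply: ltr_pwDl.
  by rewrite mulr_gt0 ?expmx_gt0 // mxE !enum_rankK.
by apply: sumr_ge0 => j _; rewrite mulr_ge0 ?expmx_ge0 // mxE corr_ge0.
Qed.

Lemma trace_corr_gt0 (x : X) : 0 < \tr (kmx (corr R (m := m) x) *m E).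
Proof.
have [ox|/eqP ox] := o =P x.
  apply: (@trace_corr_gt0_of x (excited pred0) (excited pred0)); last exact: reach_refl.
  by apply: (@corr_gt0 x pred0 (pred1 o) pred0); rewrite -?ox /= ?eqxx // => y /negbTE.
have xo : (x == o) = false by rewrite eq_sym (negbTE ox).
have move1 : creach (excited (pred1 o)) (excited (pred1 x)) ->
    0 < \tr (kmx (corr R (m := m) x) *m E).
  apply: trace_corr_gt0_of.
  apply: (@corr_gt0 x (pred1 x) (pred2 o x) (pred1 o)); rewrite /= ?eqxx ?(negbTE ox) ?xo ?orbT //.
    by move=> y /negbTE->.
  by move=> y /negbTE->; rewrite orbF.
(* Without [T] links excitations move two steps at a time, so the parity of [l1norm x] decides. *)
have [u0|u0] := ltP 0 u; first by apply: move1; apply: creach_hop.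
have u1 : u < 1 by apply: le_lt_trans u0 ltr01.
have := odd_double_half (l1norm x); rewrite -mul2n; case: (odd _); move: (_./2) => k; last first.
  rewrite add0n => e; apply: move1.
  by have := @creach_double_hop pred0 k x u1 (esym e) (fun _ _ => isT).
rewrite add1n => e; have [y xy ey] := l1norm_descent (esym e).
have ne : (x == y) = false by apply/eqP => E; move: e; rewrite E ey; lia.
(* Odd distance: the matrix element of the spin operators links the ground configuration to the pair
   at [o] and [x]. In the exponential the excitation at [o] moves to the neighbour [y] of [x], and
   one more [Q] link annihilates the pair. *)
apply: (@trace_corr_gt0_of x (excited pred0) (excited (predU (pred1 x) (pred1 o)))).
  apply: (@corr_gt0 x pred0 (pred1 o) (predU (pred1 x) (pred1 o))); rewrite /= ?eqxx ?xo //.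
    by move=> z /negbTE->.
  by move=> z /negbTE->.
apply: creach_trans (@creach_double_hop (pred1 x) k y u1 ey _) _.
  by move=> z hz /=; apply/eqP => E; move: e; rewrite -E; lia.
apply: (creach_Q u1 xy); rewrite ?excitedE /= ?eqxx ?orbT //.
by move=> z zx zy; rewrite !excitedE /= (negbTE zx) (negbTE zy).
Qed.

Lemma trace_expmx_gt0 : 0 < \tr E.
Proof.
rewrite /mxtrace sum_enum_rank (bigD1 (excited pred0)) //=; apply: ltr_pwDl.
  by apply: expmx_gt0; apply: reach_refl.
by apply: sumr_ge0 => i _; apply: expmx_ge0.
Qed.

End Positivity.

(** * Exponential decay *)

Lemma one_sub_expRN_ge (R : realType) (t : R) : 0 <= t <= 1 -> t / 2 <= 1 - expR (- t).
Proof.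
move=> /andP[t0 t1]; have e := expR_ge1Dx t.
have h : expR (- t) * (1 + t) <= 1.
  by rewrite expRN -ler_pdivlMl ?invr_gt0 ?expR_gt0 // invrK mulr1.
have p := expR_gt0 (- t); nra.
Qed.

Section Decay.
Variables (R : realType) (d m : nat) (alpha : R).
Hypothesis alpha_gt0 : 0 < alpha.

(* The rate at which the exponential tilt beats the entropy of chains of links. *)
Definition tilt : R := 16 * (2 * m.+1)%:R * (4 * 3 ^ d)%:R * expR 2.

Lemma tilt_gt0 : 0 < tilt.
Proof. by rewrite !mulr_gt0 ?expR_gt0 ?ltr0n // muln_gt0 expn_gt0. Qed.

(** The size threshold [L] for components scales like [1 / delta], so that [L * delta] is of order
    [l1norm x] and both error terms decay at a rate free of [delta]. *)
Lemma slice_decay l (u : R) (h : site d l -> R) (delta : R) M (x : site d l) :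
  0 <= u <= 1 -> (forall y, alpha <= h y) -> origin d l != x ->
  0 < delta -> delta * nedges R d l <= 2^-1 -> alpha * delta <= 1 -> tilt * delta <= 1 ->
  \tr (kmx (corr R x) *m slice_mx m u h delta ^+ M.+1) <=
    S1_bound R m ^+ 2 * m.+1%:R * (2 * m.+1)%:R *
    (expR 2 * expR (- (alpha / (4 * tilt) * (l1norm x)%:R)) + expR (- (l1norm x)%:R)) *
    \tr (slice_mx m u h delta ^+ M.+1).
Proof.
move=> u01 ha ox d0 dE ad td; have k0 := tilt_gt0.
have h0 y : 0 <= h y by apply: le_trans (ha y); apply: ltW.
have dge0 := ltW d0.
apply: le_trans (trace_corr_le m h u01 M.+1 dge0 dE x) _.
rewrite -[leRHS]mulrA -[leRHS]mulrA; apply: ler_wpM2l.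
  by rewrite mulr_ge0 ?ler0n // exprn_ge0 // S1_bound_ge0.
rewrite trace_slice_mx.
pose eta := field_eta (M := M.+1) (fun y => delta * h y).
have eta0 v : 0 <= eta v by rewrite /eta /field_eta; case: ifP => // _; rewrite mulr_ge0.
have eta1 (k : 'I_M.+1) y : delta * alpha <= eta (before k, y).
  rewrite /eta /field_eta ifF ?ler_wpM2l //=.
  by apply/negbTE; rewrite -val_eqE /= neq_ltn ltn_ord.
have w0 := link_weight0 u dE.
have w0' : 0 < @link_weight R d l u delta None by apply: lt_le_trans w0; rewrite invr_gt0.
pose n := l1norm x; pose L := Num.truncn (n%:R / (2 * tilt) / delta).
have da0 : 0 <= delta * alpha by rewrite mulr_ge0 // ltW.
have kd0 : 0 < tilt * delta by rewrite mulr_gt0.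
have S := sum_Zcut_le m (i0 := ord0) erefl (@edge_irr d l) ox (@l1norm_edge d l) (l1norm_origin d l)
  (@card_incident d l) eta0 da0 eta1 (link_weight_ge0 u01 dge0 dE) w0'
  (@link_weight_invalid _ _ _ u delta) (@link_weight_edge _ _ _ u delta dge0) kd0 L.
rewrite (eq_bigr (fun w => Wlink (link_weight u delta) w * Zcut m w (origin d l) x eta)); last first.
  by move=> w _; congr (_ * _); apply: eq_bigl => s; rewrite ox implyTb.
apply: le_trans S _; rewrite -/eta -/n -[leLHS]mulrA.
apply: ler_wpM2l; first by rewrite ler0n.
apply: ler_wpM2r.
  by apply: sumr_ge0 => w _; rewrite mulr_ge0 ?Zlink_ge0 //; apply: Wlink_ge0 => a; apply: link_weight_ge0.
have r0 : 0 <= n%:R / (2 * tilt) / delta by rewrite !divr_ge0 ?ler0n // mulr_ge0 // ltW.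
have /andP[L1 L2] := truncn_itv r0; rewrite -/L in L1 L2.
have rd : n%:R / (2 * tilt) / delta * delta = n%:R / (2 * tilt) by rewrite divfK // gt_eqF.
have Ld1 : L%:R * delta <= n%:R / (2 * tilt) by rewrite -rd ler_wpM2r.
have Ld2 : n%:R / (2 * tilt) <= (L%:R + 1) * delta by rewrite -rd ler_wpM2r // natr1 ltW.
apply: lerD.
  rewrite -expRD ler_expR.
  have -> : alpha / (4 * tilt) * n%:R = alpha * (n%:R / (2 * tilt)) / 2.
    by field; rewrite gt_eqF.
  have h2 : alpha * (n%:R / (2 * tilt)) <= alpha * ((L%:R + 1) * delta) by rewrite ler_wpM2l // ltW.
  (* Truncation and the [- 2] lose at most [3 * alpha * delta / 2 <= 3 / 2], which [expR 2]
     absorbs. *)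
  have -> : delta * alpha * (L%:R - 2) / 2 = (alpha * ((L%:R + 1) * delta) - 3 * (alpha * delta)) / 2 by ring.
  lra.
set q := (_ * delta / _ * _).
(* Since [wt None >= 1/2] and [1 - e^(-t) >= t / 2], the cost per link is at most
   [16 * (2 * m.+1) * D / tilt] with [D = 4 * 3 ^ d]; [tilt] is defined so that this equals
   [e^(-2)]. *)
have q2 : q <= expR (- 2).
  have den := @one_sub_expRN_ge R (tilt * delta); rewrite ltW // td /= in den; have {den} := den isT => den.
  have D0 : 0 <= (4 * 3 ^ d)%:R :> R by rewrite ler0n.
  have T0 : 0 <= (2 * m.+1)%:R :> R by rewrite ler0n.
  apply: (@le_trans _ _ ((2 * m.+1)%:R * delta * 2 * ((4 * 3 ^ d)%:R * (4 / (tilt * delta / 2))))).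
    apply: ler_pM.
    - by rewrite !mulr_ge0 // invr_ge0 ltW.
    - by rewrite !mulr_ge0 // invr_ge0 subr_ge0 expR_le1 oppr_le0 ltW.
    - apply: ler_wpM2l; first by rewrite mulr_ge0.
      by rewrite -[leRHS]invrK lef_pV2 ?posrE ?invr_gt0.
    - apply: ler_wpM2l => //; apply: ler_wpM2l => //.
      by rewrite lef_pV2 ?posrE ?divr_gt0 // (lt_le_trans _ den) // divr_gt0.
  rewrite expRN le_eqVlt; apply/orP; left; apply/eqP; rewrite /tilt.
  have D1 : (4 * 3 ^ d)%:R != 0 :> R by rewrite pnatr_eq0 muln_eq0 expn_eq0.
  have T1 : (2 * m.+1)%:R != 0 :> R by rewrite pnatr_eq0.
  have E1 : expR 2 != 0 :> R by rewrite expR_eq0.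
  move: D1 T1 E1; move: (4 * 3 ^ d)%:R (2 * m.+1)%:R (expR 2) => a b e a0 b0 e0.
  by field; rewrite e0 a0 b0 gt_eqF.
have q0 : 0 <= q.
  rewrite /q !mulr_ge0 ?ler0n ?invr_ge0 ?(ltW w0') // subr_ge0 expR_le1 oppr_le0 ltW //.
(* The tilt costs at most [e^n], by the choice of [L], against [e^(-2 n)] from the links. *)
apply: (@le_trans _ _ (expR (- 2) ^+ n * expR n%:R)).
  apply: ler_pM; rewrite ?exprn_ge0 ?expR_ge0 //; first by apply: lerXn2r; rewrite ?nnegrE ?expR_ge0.
  rewrite ler_expR natrM.
  have -> : tilt * delta * (2 * L%:R) = 2 * tilt * (L%:R * delta) by ring.
  apply: (@le_trans _ _ (2 * tilt * (n%:R / (2 * tilt)))).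
    by rewrite ler_wpM2l // mulr_ge0 // ltW.
  by rewrite mulrC divfK // mulf_neq0 // gt_eqF.
rewrite -expRM_natl -expRD ler_expR; lra.
Qed.

(** The constants of the slice bounds do not depend on the number of slices, so the bounds pass to
    the limit. The volume enters only through how small the time step must be. *)
Lemma gibbs_decay l (u beta : R) (h : site d l -> R) (x : site d l) :
  0 <= u <= 1 -> 0 < beta -> (forall y, alpha <= h y) ->
  gibbs beta u h (S1_op R m (origin d l) *m S1_op R m x) <=
    S1_bound R m ^+ 2 * m.+1%:R * (2 * m.+1)%:R * (expR 2 + 1) *
    expR (- Num.min (alpha / (4 * tilt)) 1 * (l1norm x)%:R).
Proof.
move=> u01 b0 ha; rewrite /gibbs corrE.
set c := Num.min _ _; set B := S1_bound R m ^+ 2 * _ * _.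
have B0 : 0 <= B by rewrite !mulr_ge0 ?ler0n ?S1_bound_ge0.
have h0 y : 0 <= h y by apply: le_trans (ha y); apply: ltW.
rewrite ler_pdivrMr ?trace_expmx_gt0 //.
have cvE i j := @slice_mx_cvg R d l m u h beta i j b0.
have cv1 := @cvg_trace R _ (kmx (corr R (m := m) x)) _ _ cvE.
have cv2 := @cvg_trace R _ 1%:M _ _ cvE.
rewrite mul1mx in cv2.
have cv3 : ((fun N => B * (expR 2 + 1) * expR (- c * (l1norm x)%:R) *
    \tr (1%:M *m slice_mx m u h (beta / N.+1%:R) ^+ N.+1)) @ \oo -->
    B * (expR 2 + 1) * expR (- c * (l1norm x)%:R) * \tr (expmx (- beta *: hamiltonian m u h)))%classic.
  by apply: cvgM; [exact: cvg_cst|exact: cv2].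
apply: (ler_cvg_to cv1 cv3).
have small (a : R) e : 0 <= a -> 0 < e -> \forall N \near (\oo)%classic, a * (beta / N.+1%:R) <= e.
  move=> a0 e0; apply: filterS (near_natr_ge (a * beta / e)) => N hN.
  by rewrite mulrA ler_pdivrMr ?ltr0n // [e * _]mulrC -ler_pdivrMr.
have nE0 : 0 <= nedges R d l by do 2!apply: sumr_ge0 => ? _.
have s1 := small (nedges R d l) 2^-1 nE0 ltac:(by rewrite invr_gt0).
have s2 := small alpha 1 (ltW alpha_gt0) ltr01.
have s3 := small tilt 1 (ltW tilt_gt0) ltr01.
near=> N; rewrite mul1mx.
have e1 : nedges R d l * (beta / N.+1%:R) <= 2^-1 by near: N.
have e2 : alpha * (beta / N.+1%:R) <= 1 by near: N.
have e3 : tilt * (beta / N.+1%:R) <= 1 by near: N.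
move: (beta / N.+1%:R) (divr_gt0 b0 (ltr0Sn R N)) e1 e2 e3 => delta d0 e1 e2 e3.
rewrite mulrC in e1.
have T0 : 0 <= \tr (slice_mx m u h delta ^+ N.+1).
  rewrite trace_slice_mx; apply: sumr_ge0 => w _.
  by rewrite mulr_ge0 ?Zlink_ge0 //; apply: Wlink_ge0 => a; apply: link_weight_ge0 => //; apply: ltW.
have [ox|/eqP ox] := origin d l =P x.
  apply: le_trans (trace_corr_diag m u01 N.+1 (ltW d0) e1 h0 ox) _; rewrite -/B.
  apply: ler_wpM2r => //; rewrite -ox l1norm_origin mulr0 expR0 mulr1 ler_peMr //.
  by rewrite lerDr expR_ge0.
apply: le_trans (slice_decay N u01 ha ox d0 e1 e2 e3) _; rewrite -/B.
apply: ler_wpM2r => //; rewrite -[leRHS]mulrA; apply: ler_wpM2l => //.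
rewrite [leRHS]mulrDl mul1r; apply: lerD.
  apply: ler_wpM2l; first exact: expR_ge0.
  by rewrite ler_expR mulNr lerN2 ler_wpM2r ?ler0n // ge_min lexx.
by rewrite ler_expR mulNr lerN2 -[leRHS]mul1r ler_wpM2r ?ler0n // ge_min lexx orbT.
Unshelve. all: by end_near.
Qed.

End Decay.

Theorem theorem1p1 (R : realType) (d m : nat) (alpha : R) :
  (0 < d)%N -> (0 < m)%N -> 0 < alpha ->
  exists C c : R, 0 < C /\ 0 < c /\
    forall (u beta : R) (l : nat) (h : site d l -> R),
      0 <= u <= 1 -> 0 < beta -> (forall x, alpha <= h x) ->
      forall x : site d l,
        0 < @gibbs R d l m beta u h (S1_op R m (origin d l) *m S1_op R m x) /\
        @gibbs R d l m beta u h (S1_op R m (origin d l) *m S1_op R m x)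
          < C * expR (- c * eucl_norm R x).
Proof.
move=> _ m0 a0; have k0 := tilt_gt0 R d m.
pose c : R := Num.min (alpha / (4 * tilt R d m)) 1.
pose C0 : R := S1_bound R m ^+ 2 * m.+1%:R * (2 * m.+1)%:R * (expR 2 + 1).
have C00 : 0 <= C0 by rewrite !mulr_ge0 ?ler0n ?addr_ge0 ?expR_ge0 ?S1_bound_ge0.
have c0 : 0 < c by rewrite lt_min ltr01 andbT divr_gt0 // mulr_gt0.
(* Adding [1] makes the constant positive and the bound strict. *)
exists (C0 + 1), c; split; [by rewrite ltr_wpDl | split=> // u beta l h u01 b0 ha x; split].
  rewrite /gibbs corrE divr_gt0 //; [exact: trace_corr_gt0|exact: trace_expmx_gt0].
apply: le_lt_trans (gibbs_decay m a0 x u01 b0 ha) _; rewrite -/C0 -/c.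
apply: (@le_lt_trans _ _ (C0 * expR (- c * eucl_norm R x))).
  by rewrite ler_wpM2l // ler_expR !mulNr lerN2 ler_wpM2l ?(ltW c0) // eucl_norm_le.
by rewrite ltr_pM2r ?expR_gt0 // ltrDl.
Qed.
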